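(* Let $0<\lambda<2$ and $F_\lambda(z)=\lambda e^z+z+\lambda+2\pi i$. Then $F_\lambda$ has wandering domains that are simply connected, unbounded and escaping. In particular, $F_\lambda$ has no Baker wandering domain.
   Context: Write $\widehat{\mathbb{C}}=\mathbb{C}\cup\{\infty\}$. The Fatou set $\mathcal{F}(f)$ of an entire function $f$ is the set of points in a neighborhood of which the iterates $\{f^n\}_{n>0}$ are defined and form a normal family; a Fatou component is a connected component of $\mathcal{F}(f)$. For a Fatou component $U$, $U_n$ denotes the Fatou component containing $f^n(U)$. $U$ is periodic if $U_p=U$ for some $p\ge 1$, pre-periodic if it is not periodic but $U_k$ is periodic for some $k>0$, and a wandering domain if it is neither periodic nor pre-periodic. A wandering domain $W$ of $f$ is escaping if $f^n(z)\to\infty$ as $n\to\infty$ for every $z\in W$. A wandering domain $W$ is a Baker wandering domain if each $W_n$ is bounded, there is a natural number $N$ such that $W_{n+1}$ surrounds $W_n$ and $0$ for all $n\ge N$, and $\mathrm{dist}(W_n,0)\to\infty$ as $n\to\infty$. Here $W_{n+1}$ surrounds $W_n$ (or $0$) if a bounded component of $\widehat{\mathbb{C}}\setminus W_{n+1}$ contains $W_n$ (or $0$), and $\mathrm{dist}$ is Euclidean distance. *)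

(* Defs.v *)
From HB Require Import structures.
From mathcomp Require Import all_boot all_order all_algebra.
From mathcomp Require Import all_classical all_reals all_analysis.
From mathcomp Require Import complex.

Set Implicit Arguments.
Unset Strict Implicit.
Unset Printing Implicit Defensive.

Import Order.TTheory GRing.Theory Num.Theory.
Import numFieldNormedType.Exports.

Local Open Scope classical_set_scope.
Local Open Scope ring_scope.
Local Open Scope complex_scope.

(* The plane [R[i]] carries the topology of its modulus, transported from the
   regular module [R[i]^o]; balls and norms are valued in [R[i]] itself, so the
   real-valued modulus is [Normc.normc]. *)
#[export] HB.instance Definition _ (R : realType) :=
  NormedModule.copy R[i] R[i]^o.

(* [None] is the point at infinity and [Some z] the finite point [z]. *)
Definition sphere (R : realType) := one_point_compactification R[i].

Definition finite_pts (R : realType) (A : set R[i]) : set (sphere R) :=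
  [set Some z | z in A].

Definition chordal (R : realType) (x y : sphere R) : R :=
  let n (z : R[i]) : R := Normc.normc z in
  match x, y with
  | Some z, Some w =>
      2 * n (z - w) / (Num.sqrt (1 + n z ^+ 2) * Num.sqrt (1 + n w ^+ 2))
  | Some z, None | None, Some z => 2 / Num.sqrt (1 + n z ^+ 2)
  | None, None => 0
  end.

Definition locally_uniform_cvg (R : realType) (V : set R[i])
    (g : nat -> R[i] -> sphere R) (h : R[i] -> sphere R) :=
  forall z, V z -> exists2 N, nbhs z N &
    forall e : R, 0 < e ->
      \forall k \near \oo, forall w, N w -> V w -> chordal (g k w) (h w) < e.

(* The limit [h] may take the value infinity. *)
Definition normal_family (R : realType) (G : set (R[i] -> sphere R))
    (V : set R[i]) :=
  forall g : nat -> R[i] -> sphere R, (forall k, G (g k)) ->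
    exists2 phi : nat -> nat, {homo phi : m n / (m < n)%N} &
      exists h, locally_uniform_cvg V (g \o phi) h.

(* The maps considered are defined on the whole plane, so that the requirement
   that the iterates be defined near a point is automatic. *)
Definition fatou_set (R : realType) (f : R[i] -> R[i]) : set R[i] :=
  [set z | exists2 V, open_nbhs z V &
     normal_family [set (fun w => Some (iter n f w)) | n in [set n | (0 < n)%N]]
       V].

Definition fatou_component (R : realType) (f : R[i] -> R[i]) (U : set R[i]) :=
  exists2 z, fatou_set f z & U = connected_component (fatou_set f) z.

(* The set [U_n]: the union ranges over the Fatou components containing
   [f^n(U)]. Fatou components being pairwise disjoint, there is at most one
   such component when [U] is nonempty, and there is one for [f] entire. *)
Definition image_component (R : realType) (f : R[i] -> R[i]) (U : set R[i])
    (n : nat) : set R[i] :=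
  \bigcup_(V in [set V | fatou_component f V /\ iter n f @` U `<=` V]) V.

Definition periodic_component (R : realType) (f : R[i] -> R[i])
    (U : set R[i]) :=
  exists2 p : nat, (0 < p)%N & image_component f U p = U.

Definition preperiodic_component (R : realType) (f : R[i] -> R[i])
    (U : set R[i]) :=
  ~ periodic_component f U /\
  exists2 k : nat, (0 < k)%N & periodic_component f (image_component f U k).

Definition wandering_domain (R : realType) (f : R[i] -> R[i]) (U : set R[i]) :=
  [/\ fatou_component f U, ~ periodic_component f U
    & ~ preperiodic_component f U].

Definition escaping (R : realType) (f : R[i] -> R[i]) (W : set R[i]) :=
  forall z, W z -> (Normc.normc (iter n f z) : R) @[n --> \oo] --> +oo.

(* For plane domains: connectivity one, i.e. the complement in the Riemann
   sphere is connected. *)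
Definition simply_connected (R : realType) (U : set R[i]) :=
  [/\ open U, connected U & connected (~` finite_pts U)].

(* A bounded component of the complement of [U] in the sphere contains [A]. *)
Definition surrounds (R : realType) (U A : set R[i]) :=
  exists2 x : sphere R, (~` finite_pts U) x &
    let K := connected_component (~` finite_pts U) x in
    (exists2 B : set R[i], bounded_set B & K = finite_pts B) /\
    finite_pts A `<=` K.

Definition dist0 (R : realType) (A : set R[i]) : R :=
  inf [set (Normc.normc z : R) | z in A].

Definition baker_wandering_domain (R : realType) (f : R[i] -> R[i])
    (W : set R[i]) :=
  [/\ wandering_domain f W,
      forall n : nat, bounded_set (image_component f W n),
      exists N : nat, forall n : nat, (N <= n)%N ->
        surrounds (image_component f W n.+1) (image_component f W n) /\
        surrounds (image_component f W n.+1) [set 0]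
    & dist0 (image_component f W n) @[n --> \oo] --> +oo].

Definition cexp (R : realType) (z : R[i]) : R[i] :=
  (expR (complex.Re z))%:C *
    (cos (complex.Im z) +i* sin (complex.Im z)).

Definition Fmap (R : realType) (lambda : R) (z : R[i]) : R[i] :=
  lambda%:C * cexp z + z + lambda%:C + (2 * pi)%:C * 'i.

(* Main.v *)
Require Import Defs.
From HB Require Import structures.
From mathcomp Require Import all_boot all_order all_algebra.
From mathcomp Require Import all_classical all_reals all_analysis.
From mathcomp Require Import complex.
From mathcomp Require Import ring lra.

Set Implicit Arguments.
Unset Strict Implicit.
Unset Printing Implicit Defensive.

Import Order.TTheory GRing.Theory Num.Theory.
Import numFieldNormedType.Exports.

Local Open Scope classical_set_scope.
Local Open Scope ring_scope.
Local Open Scope complex_scope.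

Local Notation normc := Normc.normc.

(** Let g be the map F - 2 pi i, so that g commutes with the translation by
    2 pi i and the iterates satisfy F^n(z) = g^n(z) + 2 pi i n
    ([iter_Fmap]).  For 0 < lambda < 2 the points i pi (2 k + 1) are attracting
    fixed points of g, and F permutes them by translation.  The wandering domain
    is the Fatou component W of F that contains i pi.

    Two facts decide which points are in the Fatou set.

    - On an open set where Im g^n is bounded below, F^n tends to infinity
      uniformly in the chordal distance, so this set is in the Fatou set
      ([uniform_escape_fatou]).
    - A point whose g-orbit meets a line Im = 2 pi k is not in the Fatou set
      ([not_fatou_of_real_orbit]).  On this line g is x + lambda e^x + lambda,
      the orbit runs off to the right and g is strongly expanding there:
      the images of any neighbourhood contain first discs of fixed size, and
      three steps later the point - 2 pi i n ([covers_hits_zero]).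
      So F^n has zeros close to a point at which F^n tends to infinity, and this
      contradicts normality.

    Hence, W being connected, no g^n(W) leaves the strip 0 < Im < 2 pi
    ([fixptComponent_strip]).  So F^n(W) is in the n-th translate of the strip:
    W is escaping, and the components containing F^n(W) are pairwise distinct.

    If W had a hole K in the plane, K would be compact and K together with W
    would be open.  As g^n is an open map ([power_like_open]), Im g^n has no extremum on this open
    set at a point of K, so its bounds on W hold on K as well
    ([filled_strip]).  By the first fact K is then in the Fatou set, and a
    frontier point of K would belong to W.

    On the line Im = pi the map g is the real map x + lambda (1 - e^x), for
    which |1 - e^x| decreases geometrically on the orbit of any x <= 0 as
    lambda < 2 ([ray_contraction]).  This puts the ray {x + i pi : x <= 0} in W, which is
    thus unbounded.

    Finally, W and the segment from 0 to i pi form an unbounded connected set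
    containing 0.  It is not contained in a bounded hole around 0 of the iterate
    of a Baker wandering domain, and the segment misses this iterate if it is
    far away; so W meets it, hence is contained in it, which is absurd as it is
    bounded. *)

Ltac complex_ext :=
  apply/eqP; rewrite eq_complex /=; apply/andP; split; apply/eqP; ring.

(** * The plane through its real-valued modulus *)

Section Modulus.
Variable R : realType.
Implicit Types (z w : R[i]) (x : R).

Lemma normc_ge0 z : 0 <= normc z :> R.
Proof. by case: z => a b; rewrite sqrtr_ge0. Qed.

Lemma normcD_le z w : (normc (z + w) : R) <= normc z + normc w.
Proof. exact: le_normcD. Qed.

Lemma normc_opp z : normc (- z) = normc z :> R.
Proof. by case: z => a b; rewrite /= !sqrrN. Qed.

Lemma normcB z w : normc (z - w) = normc (w - z) :> R.
Proof. by rewrite -normc_opp opprB. Qed.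

Lemma normc_triangle u z w : (normc (z - w) : R) <= normc (z - u) + normc (u - w).
Proof. by rewrite -[z - w](subrKA u) normcD_le. Qed.

Lemma normcB_ge z w : (normc z - normc w : R) <= normc (z - w).
Proof. by rewrite lerBlDr -{1}(subrK w z) normcD_le. Qed.

Lemma normcX z n : normc (z ^+ n) = normc z ^+ n :> R.
Proof.
elim: n => [|n IH]; first by rewrite !expr0 Normc.normc1.
by rewrite !exprS Normc.normcM IH.
Qed.

Lemma normc_real x : normc x%:C = `|x|.
Proof. by rewrite /= expr0n addr0 sqrtr_sqr. Qed.

Lemma normc_gt0 z : z != 0 -> 0 < normc z :> R.
Proof.
move=> z0; rewrite lt_neqAle normc_ge0 andbT eq_sym.
by apply: contra z0 => /eqP/Normc.eq0_normc ->.
Qed.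

Lemma Re_le_normc z : `|complex.Re z| <= normc z.
Proof. by case: z => a b /=; rewrite -sqrtr_sqr ler_wsqrtr// lerDl sqr_ge0. Qed.

Lemma Im_le_normc z : `|complex.Im z| <= normc z.
Proof. by case: z => a b /=; rewrite -sqrtr_sqr ler_wsqrtr// lerDr sqr_ge0. Qed.

Lemma normc_le_ReIm z : normc z <= `|complex.Re z| + `|complex.Im z|.
Proof.
case: z => a b /=; rewrite -[leRHS]ger0_norm ?addr_ge0// -sqrtr_sqr.
rewrite ler_wsqrtr// sqrrD !real_normK ?num_real// lerD2r lerDl.
by rewrite mulrn_wge0// mulr_ge0.
Qed.

Lemma ReD z w : complex.Re (z + w) = complex.Re z + complex.Re w.
Proof. by case: z; case: w. Qed.
Lemma ImD z w : complex.Im (z + w) = complex.Im z + complex.Im w.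
Proof. by case: z; case: w. Qed.
Lemma ReB z w : complex.Re (z - w) = complex.Re z - complex.Re w.
Proof. by case: z; case: w. Qed.
Lemma ImB z w : complex.Im (z - w) = complex.Im z - complex.Im w.
Proof. by case: z; case: w. Qed.

Lemma complex_norm z : `|z| = (normc z)%:C.
Proof. by []. Qed.

(** The norm of [R[i]] takes its values in [R[i]]; this lemma and the next ones
    translate the topology into estimates between real numbers. *)
Lemma nbhs_normcP z (A : set R[i]) :
  nbhs z A <-> exists2 e : R, 0 < e & forall w, normc (w - z) < e -> A w.
Proof.
split.
- move=> /nbhs_normP[e /= e0 eA].
  have eE : (complex.Re e)%:C = e by apply: RRe_real; rewrite gtr0_real.
  exists (complex.Re e); first by rewrite -ltcR eE.
  move=> w wz; apply: eA => /=.
  by rewrite -[ltRHS]eE complex_norm ltcR normcB.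
- move=> [e e0 eA]; apply/nbhs_normP; exists e%:C; first by rewrite /= ltcR.
  move=> w /=; rewrite complex_norm ltcR normcB => wz.
  exact: eA.
Qed.

Lemma open_normcP (A : set R[i]) : open A <->
  forall z, A z -> exists2 e : R, 0 < e & forall w, normc (w - z) < e -> A w.
Proof.
rewrite openE; split.
- by move=> Ao z /Ao /nbhs_normcP.
- by move=> Ao z /Ao h; apply/nbhs_normcP.
Qed.

Definition disc z (e : R) : set R[i] := [set w | normc (w - z) < e].

Lemma disc_open z e : open (disc z e).
Proof.
apply/open_normcP => w; rewrite /disc/= => wz.
exists (e - normc (w - z)); first by rewrite subr_gt0.
move=> v vw; apply: le_lt_trans (normc_triangle w _ _) _.
by rewrite -ltrBrDr.
Qed.

Lemma disc_center z e : 0 < e -> disc z e z.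
Proof. by rewrite /disc/= subrr Normc.normc0. Qed.

Lemma continuous_normcP (f : R[i] -> R[i]) z : {for z, continuous f} <->
  forall e : R, 0 < e -> exists2 d : R, 0 < d &
    forall w, normc (w - z) < d -> normc (f w - f z) < e.
Proof.
split.
- move=> fz e e0; apply/(@nbhs_normcP z (fun w => normc (f w - f z) < e)).
  suff : nbhs z (f @^-1` [set v | normc (v - f z) < e]) by [].
  by apply: fz; apply/nbhs_normcP; exists e.
- move=> fz A /nbhs_normcP[e e0 eA].
  have [d d0 dP] := fz e e0.
  apply/nbhs_normcP; exists d => // w /dP; exact: eA.
Qed.

Lemma continuous_Im : continuous (@complex.Im R : R[i] -> R).
Proof.
move=> z A /nbhs_ballP[e /= e0 eA]; apply/nbhs_normcP; exists e => // w wz.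
apply: eA; rewrite /ball/= distrC; apply: le_lt_trans wz.
by rewrite -ImB Im_le_normc.
Qed.

Lemma continuous_dist y (f : R[i] -> R[i]) : continuous f ->
  continuous (fun z => normc (f z - y) : R).
Proof.
move=> cf z A /nbhs_ballP[e /= e0 eA].
have [d d0 dP] := (continuous_normcP f z).1 (cf z) _ e0.
apply/nbhs_normcP; exists d => // w /dP fwz.
apply: eA; rewrite /ball/=; apply: le_lt_trans fwz.
have subK u v : u - y - (v - y) = u - v by rewrite opprB addrA subrK.
rewrite ler_norml lerNl opprB; apply/andP; split.
- by rewrite -(subK (f w) (f z)); exact: normcB_ge.
- by rewrite (normcB (f w) (f z)) -(subK (f z) (f w)); exact: normcB_ge.
Qed.

(** Used to import the compactness of rectangles. *)
Lemma continuous_mkcomplex : continuous (fun p : R * R => p.1 +i* p.2).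
Proof.
move=> [a b] A /nbhs_normcP[e e0 eA].
have e20 : 0 < e / 2 by rewrite divr_gt0.
exists (ball a (e / 2), ball b (e / 2)); first by split; exact: nbhsx_ballx.
move=> [c d] [] /=; rewrite /ball/= => ac bd.
apply: eA; apply: le_lt_trans (normc_le_ReIm _) _ => /=.
rewrite (distrC c) (distrC d) [ltRHS]splitr.
exact: ltrD.
Qed.

Lemma compact_cdisc z (r : R) : compact [set w | normc (w - z) <= r].
Proof.
pose Q := [set (fun p : R * R => p.1 +i* p.2) p | p in
  `[complex.Re z - r, complex.Re z + r] `*`
  `[complex.Im z - r, complex.Im z + r]].
apply: (@subclosed_compact _ _ Q).
- rewrite -openC; apply/open_normcP => w /= /negP; rewrite -ltNge => rw.
  exists (normc (w - z) - r); first by rewrite subr_gt0.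
  move=> v vw; apply/negP; rewrite -ltNge.
  rewrite -(ltrD2l (normc (v - w))); apply: (lt_le_trans (y := normc (w - z))).
    by rewrite -ltrBrDr.
  by rewrite (normcB v) normc_triangle.
- apply: continuous_compact; first exact/continuous_subspaceT/continuous_mkcomplex.
  apply: compact_setX; exact: segment_compact.
- move=> w /= wr; exists (complex.Re w, complex.Im w); last by case: w {wr}.
  have := le_trans (Re_le_normc _) wr; have := le_trans (Im_le_normc _) wr.
  rewrite ReB ImB !ler_distl => hI hR.
  by split; rewrite /= in_itv.
Qed.

Lemma star_shaped_connected (A : set R[i]) p : A p ->
  (forall w t, A w -> 0 <= t <= 1 -> A (p + t%:C * (w - p))) -> connected A.
Proof.
move=> Ap Astar.
have -> : A = \bigcup_(w in A) [set p + t%:C * (w - p) | t in `[0, 1]%classic].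
  apply/seteqP; split=> [w Aw|v [w Aw] [t /= t01 <-]].
  - exists w => //; exists 1; first by rewrite /= in_itv/= lexx ler01.
    by rewrite rmorph1 mul1r addrC subrK.
  - by apply: Astar => //; rewrite in_itv/= in t01.
apply: bigcup_connected.
- exists p => w Aw; exists 0; first by rewrite /= in_itv/= lexx ler01.
  by rewrite rmorph0 mul0r addr0.
- move=> w Aw; apply: connected_continuous_connected.
    exact: segment_connected.
  apply: continuous_subspaceT => t B /nbhs_normcP[e e0 eB].
  have k0 : 0 < normc (w - p) + 1 by rewrite ltr_wpDl ?normc_ge0.
  apply/nbhs_ballP; exists (e / (normc (w - p) + 1)); first by rewrite /= divr_gt0.
  move=> s; rewrite /ball/= ltr_pdivlMr// => ts.
  apply: eB; rewrite opprD addrACA subrr add0r -mulrBl -rmorphB.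
  rewrite Normc.normcM normc_real distrC.
  by apply: le_lt_trans ts; rewrite ler_wpM2l// lerDl.
Qed.

Lemma disc_connected z e : 0 < e -> connected (disc z e).
Proof.
move=> e0; apply: (@star_shaped_connected (disc z e) z (disc_center z e0)).
move=> w t; rewrite /disc/= => wz /andP[t0 t1].
rewrite addrAC subrr add0r Normc.normcM normc_real ger0_norm//.
by apply: le_lt_trans wz; rewrite ler_piMl// normc_ge0.
Qed.

Lemma plane_connected : connected [set: R[i]].
Proof. exact: (@star_shaped_connected _ 0). Qed.

Lemma bounded_normc (A : set R[i]) : bounded_set A ->
  exists M : R, forall z, A z -> normc z <= M.
Proof.
move=> /pinfty_ex_gt0[M _ AM]; exists (complex.Re M) => z /AM /=; rewrite complex_norm.
by rewrite lecE => /andP[_].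
Qed.

(** The plane is locally connected, discs being connected. *)
Lemma connected_component_open (A : set R[i]) z : open A ->
  open (connected_component A z).
Proof.
move=> /open_normcP Ao; apply/open_normcP => w Cw.
have Aw := connected_component_sub Cw.
have [e e0 eA] := Ao _ Aw; exists e => // v vw.
rewrite (same_connected_component Cw).
exact: (@connected_component_max _ A (disc w e) w (disc_center _ e0) eA
  (disc_connected e0) v vw).
Qed.

End Modulus.

(** * Taylor estimates for the complex exponential *)

Section Exponential.
Variable R : realType.
Implicit Types (z w h : R[i]) (x y t : R).

(** A mean value estimate that raises the order of vanishing by one.  Applied
    repeatedly it gives the Taylor bounds below; the constants are not sharp,
    only the orders matter. *)
Lemma norm_le_of_derive (f df : R -> R) (K : R) n :
  (forall x, is_derive x 1 f (df x)) -> f 0 = 0 -> 0 <= K ->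
  (forall x, `|x| <= 1 -> `|df x| <= K * `|x| ^+ n) ->
  forall x, `|x| <= 1 -> `|f x| <= K * `|x| ^+ n.+1.
Proof.
move=> fdf f0 K0 dfK x x1.
have cf : continuous f.
  by move=> u; apply/differentiable_continuous/derivable1_diffP; case: (fdf u).
have key c : `|c| <= `|x| -> `|df c * x| <= K * `|x| ^+ n.+1.
  move=> cx; rewrite normrM exprSr mulrA ler_wpM2r//.
  apply: (le_trans (dfK _ (le_trans cx x1))).
  by rewrite ler_wpM2l// lerXn2r// nnegrE.
have [x0|x0] := leP 0 x.
- have [|c] := @MVT_segment _ f df 0 x x0 (fun u _ => fdf u).
    exact: continuous_subspaceT.
  rewrite in_itv/= f0 !subr0 => /andP[c0 cx] ->; apply: key.
  by rewrite !ger0_norm// (le_trans c0).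
- have [|c] := @MVT_segment _ f df x 0 (ltW x0) (fun u _ => fdf u).
    exact: continuous_subspaceT.
  rewrite in_itv/= f0 !sub0r mulrN => /andP[c0 cx] /eqP; rewrite eqr_opp => /eqP ->.
  by apply: key; rewrite !ler0_norm// ?lerN2// ltW.
Qed.

Lemma sin_bound1 x : `|x| <= 1 -> `|sin x| <= `|x|.
Proof.
move=> x1; rewrite -[leRHS]mul1r -[leRHS]/(1 * `|x| ^+ 1).
apply: (@norm_le_of_derive sin cos 1 0) => //; first exact: sin0.
by move=> t _; rewrite expr0 mulr1 cos_max.
Qed.

Lemma cos_bound2 x : `|x| <= 1 -> `|cos x - 1| <= `|x| ^+ 2.
Proof.
move=> x1; rewrite -[leRHS]mul1r.
apply: (@norm_le_of_derive (fun x => cos x - 1) (fun x => - sin x) 1 1) => //.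
- by move=> t; apply: is_derive_eq; rewrite subr0.
- by rewrite cos0 subrr.
- by move=> t t1; rewrite normrN mul1r expr1 sin_bound1.
Qed.

Lemma sin_bound3 x : `|x| <= 1 -> `|sin x - x| <= `|x| ^+ 3.
Proof.
move=> x1; rewrite -[leRHS]mul1r.
apply: (@norm_le_of_derive (fun x => sin x - x) (fun x => cos x - 1) 1 2) => //.
- by rewrite sin0 subrr.
- by move=> t t1; rewrite mul1r cos_bound2.
Qed.

Lemma cos_bound3 x : `|x| <= 1 -> `|cos x - 1 + x ^+ 2 / 2| <= `|x| ^+ 3.
Proof.
move=> x1; rewrite -[leRHS]mul1r.
apply: (@norm_le_of_derive (fun x => cos x - 1 + x ^+ 2 / 2)
   (fun x => - sin x + x) 1 2) => //.
- move=> t; apply: is_derive_eq; rewrite ?scaler0 ?addr0 /GRing.scale/=. 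
  by field.
- by rewrite cos0 subrr expr0n mul0r addr0.
- move=> t t1; rewrite mul1r addrC distrC.
  apply: (le_trans (sin_bound3 t1)).
  by rewrite exprS ler_piMl// exprn_ge0.
Qed.

Lemma expR_le4 x : `|x| <= 1 -> expR x <= 4.
Proof.
move=> x1; apply: (le_trans (y := expR 1)).
  by rewrite ler_expR (le_trans (ler_norm _)).
have -> : 1 = 1 / 2 + 1 / 2 :> R by field.
have := expR_ge1Dx (- (1 / 2) : R); rewrite expRN expRD => h.
have e0 := expR_gt0 (1 / 2 : R).
have : expR (1 / 2) <= 2 :> R.
  by rewrite -(ler_pM2r (x := (expR (1 / 2))^-1)) ?invr_gt0// divff ?gt_eqF//; lra.
nra.
Qed.

Lemma expR_bound3 x : `|x| <= 1 ->
  `|expR x - 1 - x - x ^+ 2 / 2| <= 4 * `|x| ^+ 3.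
Proof.
have b1 t : `|t| <= 1 -> `|expR t - 1| <= 4 * `|t| ^+ 1.
  apply: (@norm_le_of_derive (fun t => expR t - 1) (expR : R -> R) 4 0) => //.
  - by move=> u; apply: is_derive_eq; rewrite subr0.
  - by rewrite expR0 subrr.
  - by move=> u u1; rewrite expr0 mulr1 gtr0_norm ?expR_gt0// expR_le4.
have b2 t : `|t| <= 1 -> `|expR t - 1 - t| <= 4 * `|t| ^+ 2.
  apply: (@norm_le_of_derive (fun t => expR t - 1 - t) (fun t => expR t - 1) 4 1) => //.
  - by move=> u; apply: is_derive_eq; rewrite subr0.
  - by rewrite expR0 subrr subr0.
apply: (@norm_le_of_derive (fun t => expR t - 1 - t - t ^+ 2 / 2)
  (fun t => expR t - 1 - t) 4 2) => //.
- move=> u; apply: is_derive_eq; rewrite ?scaler0 ?addr0 /GRing.scale/=.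
  by field.
- by rewrite expR0 subrr expr0n mul0r !subr0.
Qed.

Lemma cexpD z w : cexp (z + w) = cexp z * cexp w.
Proof.
rewrite /cexp ReD ImD expRD cosD sinD; case: z => a b; case: w => c d /=.
by apply/eqP; rewrite eq_complex /=; apply/andP; split; apply/eqP; ring.
Qed.

Lemma normc_cexp z : normc (cexp z) = expR (complex.Re z).
Proof.
rewrite /cexp Normc.normcM normc_real gtr0_norm ?expR_gt0//=.
by rewrite cos2Dsin2 sqrtr1 mulr1.
Qed.

(** The order three is needed at the critical points of g, where g is
    quadratic.  The real and imaginary parts of the remainder are each a sum of
    three terms, bounded by (4 + 3 + 1) times the cube of the modulus. *)
Lemma cexp_bound3 h : (normc h : R) <= 1 ->
  normc (cexp h - 1 - h - h ^+ 2 / 2) <= 16 * normc h ^+ 3.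
Proof.
set r := normc h => r1.
have xr := Re_le_normc h; have yr := Im_le_normc h; rewrite -/r in xr yr.
pose x := complex.Re h; pose y := complex.Im h.
rewrite -/x in xr; rewrite -/y in yr.
have hE : h = x +i* y by rewrite /x /y; case: (h).
have r0 : 0 <= r by exact: normc_ge0.
have r30 : 0 <= r ^+ 3 by rewrite exprn_ge0.
have x1 := le_trans xr r1; have y1 := le_trans yr r1.
pose e1 := expR x - 1 - x - x ^+ 2 / 2.
pose e2 := cos y - 1 + y ^+ 2 / 2.
pose e3 := sin y - y.
have X3 : `|x| ^+ 3 <= r ^+ 3 by rewrite lerXn2r ?nnegrE.
have Y3 : `|y| ^+ 3 <= r ^+ 3 by rewrite lerXn2r ?nnegrE.
have E1 : `|e1| <= 4 * r ^+ 3.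
  by apply: (le_trans (expR_bound3 x1)); rewrite ler_pM2l.
have E2 : `|e2| <= r ^+ 3 by apply: (le_trans (cos_bound3 y1)).
have E3 : `|e3| <= r ^+ 3 by apply: (le_trans (sin_bound3 y1)).
have P1 : `|1 + x + x ^+ 2 / 2| <= 3.
  move: x1; rewrite !ler_norml => /andP[] ? ?.
  have := sqr_ge0 x; nra.
have XY (a b c d : R) : `|a| <= r -> `|b| <= r -> `|c| <= r -> `|d| <= 1 ->
    `|a * b * c * d| <= r ^+ 3.
  move=> ar br cr d1; rewrite !normrM -[leRHS]mulr1 2!exprS expr1 mulrA.
  by rewrite !ler_pM ?mulr_ge0.
have -> : cexp h - 1 - h - h ^+ 2 / 2 =
  (e1 * cos y + (1 + x + x ^+ 2 / 2) * e2 - x * y * y * (1 / 2 + x / 4)) +i*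
  (e1 * sin y + (1 + x + x ^+ 2 / 2) * e3 + x * x * y * (1 / 2)).
  have -> : h ^+ 2 / 2 = ((x ^+ 2 - y ^+ 2) / 2) +i* (x * y).
    rewrite hE; apply: (mulIf (x := 2)); rewrite ?pnatr_eq0// divfK ?pnatr_eq0//.
    have -> : 2 = (2 : R)%:C by rewrite rmorph_nat.
    by apply/eqP; rewrite eq_complex /=; apply/andP; split; apply/eqP; field.
  rewrite /cexp /e1 /e2 /e3 -/x -/y hE.
  by apply/eqP; rewrite eq_complex /=; apply/andP; split; apply/eqP; field.
apply: le_trans (normc_le_ReIm _) _ => /=.
have T1 : `|e1 * cos y| <= 4 * r ^+ 3.
  by rewrite normrM -[leRHS]mulr1 ler_pM// cos_max.
have T2 : `|(1 + x + x ^+ 2 / 2) * e2| <= 3 * r ^+ 3.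
  by rewrite normrM ler_pM.
have T3 : `|x * y * y * (1 / 2 + x / 4)| <= r ^+ 3.
  apply: XY => //; move: x1; rewrite !ler_norml => /andP[] ? ?; lra.
have T4 : `|e1 * sin y| <= 4 * r ^+ 3.
  by rewrite normrM -[leRHS]mulr1 ler_pM// sin_max.
have T5 : `|(1 + x + x ^+ 2 / 2) * e3| <= 3 * r ^+ 3.
  by rewrite normrM ler_pM.
have T6 : `|x * x * y * (1 / 2)| <= r ^+ 3.
  by apply: XY => //; rewrite ger0_norm; lra.
have U1 := ler_normB (e1 * cos y + (1 + x + x ^+ 2 / 2) * e2)
  (x * y * y * (1 / 2 + x / 4)).
have U2 := ler_normD (e1 * cos y) ((1 + x + x ^+ 2 / 2) * e2).
have U3 := ler_normD (e1 * sin y + (1 + x + x ^+ 2 / 2) * e3) (x * x * y * (1 / 2)).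
have U4 := ler_normD (e1 * sin y) ((1 + x + x ^+ 2 / 2) * e3).
lra.
Qed.

Lemma cexp_bound2 h : (normc h : R) <= 1 ->
  normc (cexp h - 1 - h) <= 17 * normc h ^+ 2.
Proof.
move=> h1; have := cexp_bound3 h1.
have := normcD_le (cexp h - 1 - h - h ^+ 2 / 2) (h ^+ 2 / 2).
rewrite subrK Normc.normcM Normc.normcV normcX.
have -> : normc (2 : R[i]) = 2 :> R.
  by rewrite -(rmorph_nat (real_complex R)) normc_real normr_nat.
have := normc_ge0 h.
have : normc h ^+ 3 <= normc h ^+ 2 by rewrite ler_wiXn2l// normc_ge0.
have := sqr_ge0 (normc h). lra.
Qed.

Lemma cexp_bound1 h : (normc h : R) <= 1 -> normc (cexp h - 1) <= 18 * normc h.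
Proof.
move=> h1; have := cexp_bound2 h1.
have := normcD_le (cexp h - 1 - h) h; rewrite subrK.
have := normc_ge0 h.
have : normc h ^+ 2 <= normc h by rewrite expr2 ler_piMl// normc_ge0.
lra.
Qed.

End Exponential.

(** * Open maps and quantitative covering *)

Section OpenMap.
Variable R : realType.
Implicit Types (a b y z h : R[i]) (r s C : R) (F : R[i] -> R[i]).

(** To first nonzero order [F] behaves at [a] like a nonconstant monomial; all
    nonconstant entire functions have this property. *)
Definition power_like F a := exists k b C,
  [/\ (0 < k)%N, b != 0 &
      forall h, (normc h : R) <= 1 ->
        normc (F (a + h) - F a - b * h ^+ k) <= C * normc h ^+ k.+1].

(** A step [h] with [b * h ^+ k] a small positive multiple of [y - F a] moves
    the value of [F] towards [y]: [F] has no local minimum of the distance to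
    [y] where this distance is not zero. *)
Lemma power_like_descent F a y r : power_like F a -> y != F a -> 0 < r ->
  exists2 z, normc (z - a) < r & (normc (F z - y) : R) < normc (F a - y).
Proof.
move=> [k [b [C [k0 b0 FC]]]] yFa r0.
pose v := y - F a.
have v0 : 0 < normc v :> R by rewrite normc_gt0// subr_eq0.
pose h0 := k.-root (v / b).
have h0E : b * h0 ^+ k = v by rewrite /h0 rootCK// mulrC divfK.
pose H : R := normc h0; have H0 : 0 <= H by exact: normc_ge0.
pose D := `|C| * H ^+ k.+1 / normc v.
have D0 : 0 <= D by rewrite divr_ge0 ?mulr_ge0 ?exprn_ge0// ltW.
have Hr0 : 0 <= H / r by rewrite divr_ge0// ltW.
(* t is small enough to bound t, t H, t H / r and t D by 1 *)
pose t := (1 + H + H / r + D)^-1.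
have den : 0 < 1 + H + H / r + D by lra.
have t0 : 0 < t by rewrite invr_gt0.
have tmul u : 0 <= u -> u < 1 + H + H / r + D -> t * u < 1.
  by move=> u0 uD; rewrite /t mulrC ltr_pdivrMr// mul1r.
have t1 : t <= 1.
  by rewrite invf_le1//; lra.
have tH : t * H < 1 by apply: tmul => //; lra.
have tHr : t * H < r.
  have : t * (H / r) < 1 by apply: tmul => //; lra.
  by rewrite mulrA ltr_pdivrMr// mul1r.
have tD : t * (`|C| * H ^+ k.+1) < normc v.
  have : t * D < 1 by apply: tmul => //; lra.
  by rewrite /D mulrA ltr_pdivrMr// mul1r.
have nth : normc (t%:C * h0) = t * H.
  by rewrite Normc.normcM normc_real gtr0_norm.
exists (a + t%:C * h0); first by rewrite addrAC subrr add0r nth.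
have := FC (t%:C * h0); rewrite nth => /(_ (ltW tH)) err.
have -> : normc (F a - y) = normc v by rewrite normcB.
have -> : F (a + t%:C * h0) - y =
    (F (a + t%:C * h0) - F a - b * (t%:C * h0) ^+ k) - (1 - t ^+ k)%:C * v.
  rewrite exprMn mulrCA h0E rmorphB rmorph1 rmorphXn /v; ring.
have tk0 : 0 < t ^+ k by rewrite exprn_gt0.
have tk1 : t ^+ k <= 1 by rewrite exprn_ile1// ltW.
apply: le_lt_trans (normcD_le _ _) _.
rewrite normc_opp Normc.normcM normc_real ger0_norm ?subr_ge0//.
have : t ^+ k * (t * (`|C| * H ^+ k.+1)) < t ^+ k * normc v by rewrite ltr_pM2l.
have : C * (t * H) ^+ k.+1 <= t ^+ k * (t * (`|C| * H ^+ k.+1)).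
  rewrite exprMn (exprSr t) [X in X <= _](_ : _ = (t ^+ k * t * H ^+ k.+1) * C); last by ring.
  rewrite [leRHS](_ : _ = (t ^+ k * t * H ^+ k.+1) * `|C|); last by ring.
  by rewrite ler_wpM2l ?ler_norm// !mulr_ge0 ?exprn_ge0// ltW.
move: err; rewrite mulrBl mul1r; lra.
Qed.

(** Minimise the distance from [F] to [y] over the closed disc.  The bound on
    the circle forces the minimum into the interior, where by
    [power_like_descent] it can only be zero. *)
Lemma disc_covering F a r s : continuous F -> (forall z, power_like F z) ->
  0 < r -> (forall z, normc (z - a) = r -> 2 * s <= normc (F z - F a)) ->
  forall y, normc (y - F a) < s -> exists2 z, normc (z - a) < r & F z = y.
Proof.
move=> cF pF r0 Fs y ys.
have [||c] := @compact_EVT_min _ _ (fun z => normc (F z - y) : R)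
    [set w | normc (w - a) <= r] _ (@compact_cdisc _ a r).
- by exists a; rewrite /= subrr Normc.normc0 ltW.
- apply: continuous_subspaceT; exact: continuous_dist.
rewrite inE /= => car cmin.
have cs : normc (F c - y) < s.
  apply: le_lt_trans (cmin a _) _; last by rewrite normcB.
  by rewrite inE/= subrr Normc.normc0 ltW.
have car' : normc (c - a) < r.
  rewrite lt_neqAle car andbT; apply/eqP => /Fs.
  have := normc_triangle y (F c) (F a); lra.
exists c => //; apply/eqP; rewrite eq_sym; apply/negP => /negP yc.
have [|z zc] := @power_like_descent _ _ _ (r - normc (c - a)) (pF c) yc.
  by rewrite subr_gt0.
rewrite ltNge cmin// inE/=.
have := normc_triangle c z a; lra.
Qed.

(** On a small circle around [a] the monomial dominates the remainder, so
    [disc_covering] applies. *)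
Lemma power_like_open F : continuous F -> (forall z, power_like F z) ->
  forall U : set R[i], open U -> open (F @` U).
Proof.
move=> cF pF U /open_normcP Uo; apply/open_normcP => _ [a Ua <-].
have [e e0 eU] := Uo _ Ua.
have [k [b [C [k0 b0 FC]]]] := pF a.
have B0 := normc_gt0 b0.
(* at radius r the remainder is at most half of the monomial *)
pose r := (1 + e^-1 + 2 * `|C| / normc b)^-1.
have e10 : 0 < e^-1 by rewrite invr_gt0.
have CB : 0 <= 2 * `|C| / normc b by rewrite divr_ge0 ?mulr_ge0// ltW.
have den : 0 < 1 + e^-1 + 2 * `|C| / normc b by lra.
have r0 : 0 < r by rewrite invr_gt0.
have r1 : r <= 1 by rewrite invf_le1//; lra.
have re : r < e.
  by rewrite invf_plt ?posrE//; lra.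
have rC : 2 * (r * `|C|) <= normc b.
  have : r * (2 * `|C| / normc b) <= 1.
    by rewrite ler_pdivrMl// mulr1; lra.
  by rewrite [r * _]mulrA ler_pdivrMr// mul1r mulrCA.
have rk0 : 0 < r ^+ k by rewrite exprn_gt0.
exists (normc b * r ^+ k / 4); first by rewrite divr_gt0 ?mulr_gt0.
move=> y yF.
have [|z zr zy] := @disc_covering F a r _ cF pF r0 _ y yF; last first.
  by exists z => //; apply: eU; apply: lt_trans re.
move=> z zr; have := FC (z - a); rewrite zr (addrC a) subrK => /(_ r1) err.
have := normcB_ge (b * (z - a) ^+ k) (b * (z - a) ^+ k - (F z - F a)).
rewrite subKr (normcB (b * _)) Normc.normcM normcX zr.
have : C * r ^+ k.+1 <= r ^+ k * (normc b / 2).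
  rewrite exprSr mulrCA ler_pM2l// mulrC.
  apply: (le_trans (y := r * `|C|)); first by rewrite ler_pM2l// ler_norm.
  by rewrite ler_pdivlMr// mulrC.
lra.
Qed.

Lemma iter_open F : (forall U : set R[i], open U -> open (F @` U)) ->
  forall n (U : set R[i]), open U -> open (iter n F @` U).
Proof.
move=> Fo n U Uo; elim: n => [|n IH]; first by rewrite image_id.
rewrite (_ : iter n.+1 F = F \o iter n F); last by [].
by rewrite -image_comp; exact: Fo.
Qed.

Lemma iter_continuous F : continuous F -> forall n, continuous (iter n F).
Proof.
move=> cF; elim=> [|n IH] z; first exact: cvg_id.
rewrite (_ : iter n.+1 F = F \o iter n F); last by [].
by apply: continuous_comp; [exact: IH|exact: cF].
Qed.

End OpenMap.

Section BaseMap.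
Variables (R : realType) (lambda : R).
Implicit Types (a z h y : R[i]).

(** The map F - 2 pi i. *)
Definition baseMap z : R[i] := lambda%:C * cexp z + z + lambda%:C.
Local Notation g := baseMap.
(** The derivative of g at [a] is [1 + expTerm a]. *)
Definition expTerm a : R[i] := lambda%:C * cexp a.

Lemma baseMap_incr a h : g (a + h) - g a = h + expTerm a * (cexp h - 1).
Proof. by rewrite /g /expTerm cexpD; ring. Qed.

(** At a critical point the linear term [1 + expTerm a] vanishes, and then the
    quadratic one has coefficient [- 1 / 2]. *)
Lemma baseMap_power_like a : power_like g a.
Proof.
have [c1|c1] := eqVneq (1 + expTerm a) 0.
- exists 2%N, (- 2^-1), 16; split => //.

  move=> h h1; rewrite baseMap_incr.
  have -> : expTerm a = -1 by apply/eqP; rewrite -addr_eq0 addrC c1.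
  rewrite -normc_opp.
  rewrite (_ : - _ = cexp h - 1 - h - h ^+ 2 / 2); first exact: cexp_bound3.
  by ring.
- exists 1%N, (1 + expTerm a), (normc (expTerm a) * 17); split => // h h1.
  rewrite baseMap_incr.
  rewrite (_ : _ - _ = expTerm a * (cexp h - 1 - h)); last by ring.
  rewrite Normc.normcM -mulrA ler_wpM2l ?normc_ge0//.
  exact: cexp_bound2.
Qed.

Lemma baseMap_continuous : continuous g.
Proof.
move=> a; apply/continuous_normcP => e e0.
pose K := 1 + normc (expTerm a) * 18; have K0 : 0 < K.
  by rewrite ltr_wpDr// mulr_ge0 ?normc_ge0.
pose d := (1 + K / e)^-1.
have Ke : 0 < K / e by rewrite divr_gt0.
have d0 : 0 < d by rewrite invr_gt0; lra.
exists d => // w wd.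
have w1 : normc (w - a) <= 1.
  by apply: (le_trans (ltW wd)); rewrite invf_le1; lra.
have -> : g w - g a = (w - a) + expTerm a * (cexp (w - a) - 1).
  by rewrite -baseMap_incr (addrC a) subrK.
apply: le_lt_trans (normcD_le _ _) _; rewrite Normc.normcM.
have b := cexp_bound1 w1.
apply: (le_lt_trans (y := K * normc (w - a))).
  rewrite /K mulrDl mul1r lerD2l -mulrA ler_wpM2l ?normc_ge0//.
apply: (lt_trans (y := K * d)); first by rewrite ltr_pM2l.
rewrite /d ltr_pdivrMr; last lra.
by rewrite mulrDr mulr1 mulrCA divff ?gt_eqF// mulr1; lra.
Qed.

Lemma baseMap_open (U : set R[i]) : open U -> open (g @` U).
Proof.
exact: power_like_open baseMap_continuous baseMap_power_like U.
Qed.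

(** For a radius at most 1 / 34 the quadratic error 17 r^2 of the exponential
    is at most half of the linear term r. *)
Lemma baseMap_covering a r : 4 <= normc (expTerm a) -> 0 < r <= 34^-1 ->
  forall y, normc (y - g a) < normc (expTerm a) * r / 8 ->
  exists2 z, normc (z - a) < r & g z = y.
Proof.
move=> c4 /andP[r0 r34]; apply: disc_covering => //.
- exact: baseMap_continuous.
- exact: baseMap_power_like.
move=> z zr.
have -> : g z - g a = (z - a) + expTerm a * (cexp (z - a) - 1).
  by rewrite -baseMap_incr (addrC a) subrK.
have r1 : normc (z - a) <= 1 by rewrite zr; lra.
have b2 := cexp_bound2 r1; rewrite zr in b2.
set E := cexp (z - a) - 1 in b2 *.
have h1 : r / 2 <= normc E.
  have := normcB_ge (z - a) (z - a - E).
  rewrite subKr zr (normcB (z - a)).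
  have : 17 * r ^+ 2 <= r / 2 by rewrite expr2 mulrA mulrC ler_pM2l//; lra.
  lra.
have := normcB_ge (expTerm a * E) (- (z - a)).
rewrite opprK normc_opp zr Normc.normcM [_ + (z - a)]addrC.
have : normc (expTerm a) * (r / 2) <= normc (expTerm a) * normc E by rewrite ler_wpM2l ?normc_ge0.
have : 4 * r <= normc (expTerm a) * r by rewrite ler_pM2r.
lra.
Qed.

End BaseMap.

(** * Criteria for the Fatou set *)

Lemma increasing_subsequence (P : nat -> nat -> Prop) :
  (forall j K, exists2 k, (K <= k)%N & P j k) ->
  exists2 phi : nat -> nat, {homo phi : m n / (m < n)%N} &
    forall j, P j (phi j).
Proof.
move=> H.
have /choice[next nextP] : forall jK : nat * nat,
    exists k, (jK.2 <= k)%N /\ P jK.1 k.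
  by move=> [j K]; have [k Kk Pk] := H j K; exists k.
pose phi := fix phi j :=
  if j is i.+1 then next (i.+1, (phi i).+1) else next (0, 0)%N.
exists phi.
- apply: homo_ltn; first exact: ltn_trans.
  by move=> i; have [] := nextP (i.+1, (phi i).+1).
- by case=> [|j]; [have [] := nextP (0, 0)%N|have [] := nextP (j.+1, (phi j).+1)].
Qed.

(** Applied to the exponents of a sequence of iterates, this leaves two cases
    for normality: a constant sequence, or iterates of increasing order. *)
Lemma constant_or_diverging_subsequence (n : nat -> nat) :
  exists2 phi : nat -> nat, {homo phi : i j / (i < j)%N} &
    (exists m, forall k, n (phi k) = m) \/ (forall k, (k <= n (phi k))%N).
Proof.
have [[m mP]|nex] :=
    pselect (exists m, forall K, exists2 k, (K <= k)%N & n k = m).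
  have [phi phiI phiP] := @increasing_subsequence (fun _ k => n k = m) (fun _ => mP).
  by exists phi => //; left; exists m.
have large j : exists K, forall k, (K <= k)%N -> (j <= n k)%N.
  elim: j => [|j [K KP]]; first by exists 0%N.
  have /existsNP[K' K'P] : ~ (forall K, exists2 k, (K <= k)%N & n k = j).
    by move=> h; apply: nex; exists j.
  exists (maxn K K') => k; rewrite geq_max => /andP[Kk K'k].
  rewrite ltn_neqAle KP// andbT; apply/eqP => jk.
  by apply: K'P; exists k.
have [|phi phiI phiP] := @increasing_subsequence (fun j k => j <= n k)%N.
  move=> j K; have [K' K'P] := large j.
  by exists (maxn K K'); [exact: leq_maxl|apply: K'P; exact: leq_maxr].
by exists phi => //; right.
Qed.

Section Fatou.
Variable R : realType.
Implicit Types (z w u v : R[i]) (f : R[i] -> R[i]).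

Lemma chordal_self (x : sphere R) : chordal x x = 0.
Proof. by case: x => //= z; rewrite subrr Normc.normc0 mulr0 mul0r. Qed.

Lemma chordal_infty_le z : 0 < normc z :> R ->
  chordal (Some z) None <= 2 / normc z.
Proof.
move=> z0 /=; rewrite ler_pM2l// lef_pV2 ?posrE ?sqrtr_gt0.
- rewrite -{1}[normc z]ger0_norm ?normc_ge0// -sqrtr_sqr ler_wsqrtr//.
  by rewrite lerDr.
- by rewrite ltr_wpDr// sqr_ge0.
- by [].
Qed.

(** A substitute for the triangle inequality of the chordal distance: a value
    close to the same [h] as 0 is finite and small. *)
Lemma chordal_zero_lt v (h : sphere R) : chordal (Some 0) h < 1 / 2 ->
  chordal (Some v) h < 1 / 2 -> (normc v : R) < 1.
Proof.
case: h => [u|]; lazy zeta beta iota delta [chordal]; last first.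
  rewrite Normc.normc0 expr0n addr0 sqrtr1; lra.
rewrite sub0r normc_opp Normc.normc0 expr0n addr0 sqrtr1 [1 * Num.sqrt _]mul1r.
have sq (t : R) : 0 <= t -> 0 < Num.sqrt (1 + t ^+ 2) /\ Num.sqrt (1 + t ^+ 2) <= 1 + t.
  move=> t0; split; first by rewrite sqrtr_gt0 ltr_wpDr// sqr_ge0.
  rewrite -[leRHS]ger0_norm ?addr_ge0// -sqrtr_sqr ler_wsqrtr//.
  by rewrite sqrrD expr1n mul1r lerD2r lerDl mulrn_wge0.
have [u0 uB] := sq _ (normc_ge0 u); have [v0 vB] := sq _ (normc_ge0 v).
rewrite ltr_pdivrMr// => h1.
rewrite ltr_pdivrMr ?mulr_gt0// => h2.
have := normcB_ge v u; have nu := normc_ge0 u; have nv := normc_ge0 v.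
have u3 : normc u <= 1 / 3 by lra.
have : Num.sqrt (1 + normc v ^+ 2) * Num.sqrt (1 + normc u ^+ 2) <=
    (1 + normc v) * (4 / 3).
  by apply: ler_pM (ltW v0) (ltW u0) vB _; lra.
lra.
Qed.

Lemma fatou_set_open f : open (fatou_set f).
Proof.
rewrite openE => z [V [Vo Vz] nV]; rewrite /interior.
apply: (filterS (P := V)); last exact: open_nbhs_nbhs.
by move=> w Vw; exists V.
Qed.

(** Either a subsequence repeats the same iterate, or it converges to infinity
    uniformly on [U]. *)
Lemma uniform_escape_fatou f (U : set R[i]) (C : R) n0 : open U ->
  (forall z n, U z -> (n0 <= n)%N -> n%:R <= normc (iter n f z) + C) ->
  U `<=` fatou_set f.
Proof.
move=> Uo Uesc z Uz; exists U => // G GP.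
have /choice[n nP] : forall k, exists n, (0 < n)%N /\ G k = fun w => Some (iter n f w).
  by move=> k; have [n n0' nE] := GP k; exists n; split.
have [phi phiI [[m mP]|large]] := constant_or_diverging_subsequence n.
- exists phi => //; exists (G (phi 0%N)) => w Uw; exists U; first by apply: open_nbhs_nbhs.
  move=> e e0; apply: nearW => k v _ _ /=.
  by rewrite !(nP _).2 !mP chordal_self.
- exists phi => //; exists (fun=> None) => w Uw; exists U; first by apply: open_nbhs_nbhs.
  move=> e e0.
  pose M := 2 / e; have M0 : 0 < M by rewrite divr_gt0.
  exists (maxn n0 (Num.truncn (M + `|C|)).+1) => // k /=; rewrite geq_max => /andP[nk Mk].
  move=> v Uv _; rewrite (nP _).2; set p := n (phi k).
  have kp : (k <= p)%N by exact: large.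
  have := Uesc v p Uv (leq_trans nk kp).
  have pM : M + `|C| < p%:R.
    apply: (lt_le_trans (truncnS_gt _)); rewrite ler_nat; exact: leq_trans kp.
  have := ler_norm C => h1 h2.
  have Mv : M < normc (iter p f v) by lra.
  have v0 := lt_trans M0 Mv.
  apply: (le_lt_trans (chordal_infty_le v0)).
  by rewrite ltr_pdivrMr// mulrC -ltr_pdivrMr.
Qed.

(** Let [h] be a locally uniform limit of iterates.  At points near [z] an
    early iterate is already large, so [h] is close to infinity there; but at
    zeros of later iterates [h] is close to 0. *)
Lemma zeros_near_escaping_not_fatou f z : continuous f ->
  (forall M : R, exists n0, forall n, (n0 <= n)%N -> M < normc (iter n f z)) ->
  (forall N, nbhs z N -> exists n0, forall n, (n0 <= n)%N ->
     exists2 w, N w & iter n f w = 0) ->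
  ~ fatou_set f z.
Proof.
move=> cf zesc zzero [V [Vo Vz]] nV.
have [|phi phiI [h hP]] := nV (fun k w => Some (iter k.+1 f w)).
  by move=> k; exists k.+1.
have [N Nz NP] := hP z Vz.
have [|K _ KP] := NP (1 / 2); first by rewrite divr_gt0.
have phi_ge k : (k <= phi k)%N.
  by elim: k => // k IH; apply: (leq_ltn_trans IH); exact: phiI.
have [n1 n1P] := zesc 2.
pose k0 := maxn K n1; pose p := (phi k0).+1.
have zp : 2 < normc (iter p f z).
  apply: n1P; apply: leqW; apply: leq_trans (phi_ge k0); exact: leq_maxr.
have : nbhs z (iter p f @^-1` [set v | normc (v - iter p f z) < 1]).
  apply: (iter_continuous cf); apply/nbhs_normcP; by exists 1.
move=> near_p.
have [|n2 n2P] := zzero (N `&` V `&` (iter p f @^-1` [set v | normc (v - iter p f z) < 1])).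
  by apply: filterI => //; apply: filterI => //; exact: open_nbhs_nbhs.
pose k1 := maxn K n2.
have [|w [[Nw Vw] wp] w0] := n2P (phi k1).+1.
  apply: leqW; apply: leq_trans (phi_ge k1); exact: leq_maxr.
have /= hw := KP k1 (leq_maxl _ _) w Nw Vw.
have /= hv := KP k0 (leq_maxl _ _) w Nw Vw.
have := @chordal_zero_lt (iter p f w) (h w).
rewrite /= in wp.
move: hw; rewrite -iterS w0 => hw /(_ hw hv).
have := normcB_ge (iter p f z) (iter p f w); rewrite normcB; lra.
Qed.

End Fatou.

(** * Iterates of F and horizontal lines *)

Section Translation.
Variables (R : realType) (lambda : R).
Implicit Types (z w : R[i]) (x t : R) (n k : nat).
Local Notation g := (baseMap lambda).
Local Notation f := (Fmap lambda).

Definition vert t : R[i] := 0 +i* t.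

Lemma vertD s t : vert (s + t) = vert s + vert t.
Proof. by complex_ext. Qed.

Lemma turnS n : 2 * pi * n.+1%:R = 2 * pi * n%:R + 2 * pi :> R.
Proof. by rewrite -(natr1 n) mulrDr mulr1. Qed.

Lemma cexp_turns n : cexp (vert (2 * pi * n%:R)) = 1.
Proof.
have turn : cexp (vert (2 * pi)) = 1.
  rewrite /cexp /= expR0 mulr_natl cos2pi sin2pi.
  by complex_ext.
elim: n => [|n IH].
  rewrite mulr0 /cexp /= expR0 cos0 sin0.
  by complex_ext.
by rewrite turnS vertD cexpD IH turn mulr1.
Qed.

Lemma baseMap_turns z n :
  g (z + vert (2 * pi * n%:R)) = g z + vert (2 * pi * n%:R).
Proof. by rewrite /baseMap cexpD cexp_turns mulr1; ring. Qed.

Lemma FmapE z : f z = g z + vert (2 * pi).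
Proof.
rewrite /Fmap /baseMap; congr (_ + _).
by complex_ext.
Qed.

Lemma iter_Fmap n z : iter n f z = iter n g z + vert (2 * pi * n%:R).
Proof.
elim: n => [|n IH] /=.
  by rewrite mulr0; case: z => a b; complex_ext.
by rewrite IH FmapE baseMap_turns turnS vertD addrA.
Qed.

Lemma Re_iter_Fmap n z : complex.Re (iter n f z) = complex.Re (iter n g z).
Proof. by rewrite iter_Fmap ReD addr0. Qed.

Lemma Im_iter_Fmap n z :
  complex.Im (iter n f z) = complex.Im (iter n g z) + 2 * pi * n%:R.
Proof. by rewrite iter_Fmap ImD. Qed.

Lemma Fmap_continuous : continuous f.
Proof.
move=> z; apply/continuous_normcP => e e0.
have [d d0 dP] := (continuous_normcP g z).1 (@baseMap_continuous R lambda z) e e0.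
exists d => // w /dP; rewrite !FmapE (_ : g w + _ - _ = g w - g z) //; ring.
Qed.

Lemma iter_baseMap_continuous n : continuous (iter n g).
Proof. exact/iter_continuous/baseMap_continuous. Qed.

Lemma iter_baseMap_open n (U : set R[i]) : open U -> open (iter n g @` U).
Proof. by apply: iter_open => ?; exact: baseMap_open. Qed.

End Translation.

Section Julia.
Variables (R : realType) (lambda : R).
Hypothesis lambda_gt0 : 0 < lambda.
Implicit Types (z w : R[i]) (x t : R) (n k : nat).
Local Notation g := (baseMap lambda).

(** Along an orbit on a horizontal line, the number of steps is bounded by an
    affine function of the position; this makes it negligible against the
    expansion. *)
Lemma exp_dominates (A B : R) : exists X0 : R, forall X, X0 <= X ->
  A + B * X <= lambda * expR X.
Proof.
exists (1 + 2 / lambda * (`|A| + `|B|)) => X.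
set D : R := `|A| + `|B|; have D0 : 0 <= D by rewrite addr_ge0.
have l0 : 0 <= 2 / lambda * D by rewrite mulr_ge0// divr_ge0// ltW.
move=> XD; have X1 : 1 <= X by lra.
have X0 : 0 < X by lra.
have XL : 2 * D <= lambda * X.
  have : 2 / lambda * D <= X by lra.
  by rewrite mulrAC ler_pdivrMr// (mulrC X).
have := @expR_ge1Dxn _ X 1 (ltW (lt_le_trans ltr01 X1)) => eX.
have : lambda * (1 + X ^+ 2 / 2) <= lambda * expR X.
  rewrite ler_pM2l//; apply: le_trans eX; rewrite lerD2l.
have : D * X <= lambda * X * X / 2.
  by rewrite ler_pdivlMr// mulrAC ler_pM2r// mulrC.
have : A <= `|A| * X by apply: (le_trans (ler_norm A)); rewrite ler_peMr.
have : B * X <= `|B| * X by rewrite ler_pM2r// ler_norm.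
move=> hB hA hD hE.
have hDE : D * X = `|A| * X + `|B| * X by rewrite /D mulrDl.
rewrite mulrDr mulr1 expr2 !mulrA in hE.
have := lambda_gt0; lra.
Qed.

Lemma pi_le4 : pi <= 4 :> R.
Proof. have := (@pihalf_02_cos_pihalf R).1; lra. Qed.

Lemma normc_expTerm z :
  normc (expTerm lambda z) = lambda * expR (complex.Re z) :> R.
Proof. by rewrite /expTerm Normc.normcM normc_real normc_cexp gtr0_norm. Qed.

Lemma expTerm_polar x t :
  expTerm lambda (x +i* t) = (lambda * expR x * cos t) +i* (lambda * expR x * sin t).
Proof.
rewrite /expTerm /cexp /=; by complex_ext.
Qed.

Lemma baseMap_polar x t : g (x +i* t) =
  (lambda * expR x * cos t + x + lambda) +i* (lambda * expR x * sin t + t).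
Proof.
have := expTerm_polar x t; rewrite /expTerm /baseMap => ->.
by complex_ext.
Qed.

Lemma cos_turns t n : cos (2 * pi * n%:R + t) = cos t.
Proof.
rewrite mulr_natl mulr_natr addrC; have /periodicn := @cosD2pi R; exact.
Qed.

Lemma sin_turns t n : sin (2 * pi * n%:R + t) = sin t.
Proof.
rewrite mulr_natl mulr_natr addrC; have /periodicn := @sinD2pi R; exact.
Qed.

Definition horizontal_orbit z n k := forall j,
  complex.Im (iter (n + j) g z) = 2 * pi * k%:R /\
  complex.Re (iter (n + j) g z) >= complex.Re (iter n g z) + lambda * j%:R.

Lemma horizontal_orbitP z n k :
  complex.Im (iter n g z) = 2 * pi * k%:R -> horizontal_orbit z n k.
Proof.
move=> Imz; elim=> [|j [IHi IHr]]; first by rewrite addn0 mulr0 addr0.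
rewrite addnS iterS.
case: (iter (n + j) g z) IHi IHr => a b /= -> ar.
rewrite -[_ * k%:R]addr0 cos_turns sin_turns cos0 sin0 !(mulr0, mulr1, add0r, addr0).
split; first by ring.
have := mulr_gt0 lambda_gt0 (expR_gt0 a).
have -> : lambda * j.+1%:R = lambda * j%:R + lambda by rewrite -(natr1 j) mulrDr mulr1.
lra.
Qed.

End Julia.

Section Covering.
Variables (R : realType) (lambda : R).
Implicit Types (z w : R[i]) (x t : R) (n k : nat).
Local Notation g := (baseMap lambda).

Definition covers z (N : set R[i]) m (r : R) :=
  forall y, normc (y - iter m g z) < r -> exists2 w, N w & iter m g w = y.

(** By [baseMap_covering] the radius is multiplied by at least 16 / 8. *)
Lemma covers_double z (N : set R[i]) m r : covers z N m r -> 0 < r <= 34^-1 ->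
  16 <= normc (expTerm lambda (iter m g z)) -> covers z N m.+1 (2 * r).
Proof.
move=> cov r0 c16 y yr.
have [||u ur gu] := @baseMap_covering R lambda (iter m g z) r _ r0 y.
- by apply: le_trans c16; lra.
- apply: lt_le_trans yr _.
  have : 16 * r <= normc (expTerm lambda (iter m g z)) * r.
    by rewrite ler_wpM2r//; case/andP: r0 => /ltW.
  lra.
by have [w Nw wu] := cov u ur; exists w => //; rewrite iterS wu.
Qed.

(** The image of [N] is open, hence contains some disc, whose radius then
    doubles until it exceeds 1 / 34. *)
Lemma covers_eventually z (N : set R[i]) m0 : open N -> N z ->
  (forall m, (m0 <= m)%N -> 16 <= normc (expTerm lambda (iter m g z))) ->
  exists m1, forall m, (m1 <= m)%N -> covers z N m 34^-1.
Proof.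
move=> No Nz c16.
have [|r r0 rP] := (open_normcP _).1 (@iter_baseMap_open R lambda m0 N No)
  (iter m0 g z); first exact: imageP.
have cov0 : covers z N m0 r by move=> y /rP [w Nw wy]; exists w.
have covj j : covers z N (m0 + j) (Num.min 34^-1 (2 ^+ j * r)).
  elim: j => [|j IH].
    rewrite addn0 expr0 mul1r => y; rewrite lt_min => /andP[_]; exact: cov0.
  rewrite addnS => y yr.
  apply: (covers_double IH _ (c16 _ (leq_addr _ _))).
    by rewrite lt_min ge_min lexx mulr_gt0 ?exprn_gt0 ?andbT//; lra.
  apply: (lt_le_trans yr); rewrite exprS -mulrA.
  set s := _ * r; rewrite /Num.min; case: ifP => h; case: ifP => h'; lra.
pose j := (Num.truncn r^-1).+1.
exists (m0 + j)%N => m jm y yr.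
have mE : (m0 + (m - m0))%N = m by rewrite subnKC// (leq_trans _ jm)// leq_addr.
have := covj (m - m0)%N y; rewrite mE; apply.
apply: (lt_le_trans yr); rewrite le_min lexx /=.
have : r^-1 < (2 ^+ (m - m0)).
  apply: (lt_trans (truncnS_gt _)).
  rewrite -natrX ltr_nat; apply: (leq_ltn_trans _ (ltn_expl _ _)) => //.
  by rewrite leq_subRL ?(leq_trans _ jm)// leq_addr.
rewrite -(ltr_pM2r r0) mulVf ?gt_eqF//; lra.
Qed.
End Covering.

Section NotFatou.
Variables (R : realType) (lambda : R).
Hypotheses (lambda_gt0 : 0 < lambda) (lambda_lt2 : lambda < 2).
Implicit Types (z w : R[i]) (x t : R) (n k : nat).
Local Notation g := (baseMap lambda).
Local Notation f := (Fmap lambda).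

(** The image of the disc around [x + 2 pi i k] contains a disc of radius
    about e^x, but only points with large real part, so the target - 2 pi i m is
    not yet in it.  One goes on to a point where g is far from the real
    direction: a quarter turn above the new centre, g has a value of
    height about Y = lambda e^X, with a surrounding disc of radius Y / 272, and in
    this disc there is a point B where lambda e^B = - i Y cancels the height.
    The value at B has size of order X, and the disc of radius Y / 272 around
    it contains the target.  Here 272 = 8 * 34. *)
Lemma covers_hits_zero z (N : set R[i]) m k (x X : R) :
  iter m g z = x +i* (2 * pi * k%:R) -> X = lambda * expR x + x + lambda ->
  covers lambda z N m 34^-1 ->
  1000 <= lambda * expR x -> 272 * (30 + 8 * k%:R) <= lambda * expR X ->
  0 <= X -> 272 * (X + 40 + 8 * m%:R) <= lambda * expR X ->
  exists2 w, N w & iter m.+3 f w = 0.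
Proof.
move=> zE XE cov cx cX X0 cXm.
have r34 : 0 < (34^-1 : R) <= 34^-1 by lra.
have l0 := lambda_gt0; have l2 := lambda_lt2.
have pi0 := pi_gt0 R; have pi4 := pi_le4 R.
set Y := lambda * expR X in cX cXm.
have k0 : 0 <= k%:R :> R by exact: ler0n.
have m0 : 0 <= m%:R :> R by exact: ler0n.
(* the first image disc is centred at A1, on a horizontal invariant line *)
pose A1 : R[i] := X +i* (2 * pi * k%:R).
have gz : g (iter m g z) = A1.
  rewrite zE baseMap_polar /A1 XE -[2 * pi * _]addr0 cos_turns sin_turns cos0 sin0.
  by complex_ext.
have step1 u : normc (u - A1) < lambda * expR x / 272 ->
    exists2 w, N w & iter m.+1 g w = u.
  move=> uA.
  have nc : normc (expTerm lambda (iter m g z)) = lambda * expR x.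
    by rewrite normc_expTerm// zE.
  have [||v vz gv] := @baseMap_covering R lambda (iter m g z) _ _ r34 u.
  - by rewrite nc; lra.
  - by rewrite nc gz; lra.
  by have [w Nw wv] := cov v vz; exists w => //; rewrite iterS wv.
(* a quarter turn above, where the derivative points upwards *)
pose A2 : R[i] := X +i* (2 * pi * k%:R + pi / 2).
have gA2 : g A2 = (X + lambda) +i* (Y + 2 * pi * k%:R + pi / 2).
  rewrite baseMap_polar cos_turns sin_turns cos_pihalf sin_pihalf /Y.
  by complex_ext.
have step2 u : normc (u - g A2) < Y / 272 -> exists2 w, N w & iter m.+2 g w = u.
  move=> uA.
  have nc : normc (expTerm lambda A2) = Y by rewrite normc_expTerm.
  have [||v vA gv] := @baseMap_covering R lambda A2 _ _ r34 u.
  - by rewrite nc; lra.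
  - by rewrite nc; lra.
  have [|w Nw wv] := step1 v; last by exists w => //; rewrite iterS wv.
  have := normc_triangle A2 v A1.
  have : normc (A2 - A1) <= pi / 2.
    apply: le_trans (normc_le_ReIm _) _; rewrite ReB ImB /= subrr normr0 add0r.
    by rewrite [2 * pi * _ + _]addrC addrK ger0_norm// divr_ge0// ltW.
  lra.
pose q := (Num.truncn (Y / (2 * pi))).+1.
have pi20 : 0 < 2 * pi :> R by lra.
have Y0 : 0 <= Y by lra.
have q1 : Y < 2 * pi * q%:R.
  by rewrite mulrC -ltr_pdivrMr// truncnS_gt.
have q2 : 2 * pi * q%:R <= Y + 2 * pi.
  rewrite -(natr1 (Num.truncn _)) mulrDr mulr1 lerD2r mulrC -ler_pdivlMr//.
  by rewrite truncn_le// divr_ge0// ltW.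
(* a three-quarter turn, at a height close to Y, is sent close to the origin *)
pose B : R[i] := X +i* (2 * pi * q%:R + (- (pi / 2))).
have gB : g B = (X + lambda) +i* (2 * pi * q%:R - pi / 2 - Y).
  rewrite baseMap_polar cos_turns sin_turns cosN sinN cos_pihalf sin_pihalf /Y.
  by complex_ext.
have step3 u : normc (u - g B) < Y / 272 -> exists2 w, N w & iter m.+3 g w = u.
  move=> uB.
  have nc : normc (expTerm lambda B) = Y by rewrite normc_expTerm.
  have [||v vB gv] := @baseMap_covering R lambda B _ _ r34 u.
  - by rewrite nc; lra.
  - by rewrite nc; lra.
  have [|w Nw wv] := step2 v; last by exists w => //; rewrite iterS wv.
  have tri := normc_triangle B v (g A2).
  have dB : normc (B - g A2) <= lambda + (20 + 8 * k%:R).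
    apply: le_trans (normc_le_ReIm _) _; rewrite ReB ImB gA2 /=.
    have -> : `|X - (X + lambda)| = lambda by rewrite opprD addNKr normrN gtr0_norm.
    have pk4 : pi * k%:R <= 4 * k%:R :> R by rewrite ler_wpM2r.
    have pk0 : 0 <= pi * k%:R :> R by rewrite mulr_ge0// ltW.
    by rewrite lerD2l ler_norml; lra.
  lra.
have [|w Nw wE] := step3 (vert (- (2 * pi * m.+3%:R))); last first.
  exists w => //; rewrite iter_Fmap wE -vertD addNr //.
apply: le_lt_trans (normc_le_ReIm _) _.
rewrite ReB ImB gB /=.
have -> : `|0 - (X + lambda)| = X + lambda by rewrite sub0r normrN ger0_norm; lra.
have mS : m.+3%:R = m%:R + 3 :> R by rewrite -natrD addn3.
have : `|- (2 * pi * m.+3%:R) - (2 * pi * q%:R - pi / 2 - Y)| <= 36 + 8 * m%:R.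
  have : pi * m%:R <= 4 * m%:R :> R by rewrite ler_wpM2r.
  have : 0 <= pi * m%:R :> R by rewrite mulr_ge0// ltW.
  rewrite mS ler_norml; lra.
lra.
Qed.

End NotFatou.

Section RealOrbit.
Variables (R : realType) (lambda : R).
Hypotheses (lambda_gt0 : 0 < lambda) (lambda_lt2 : lambda < 2).
Implicit Types (z w : R[i]) (x t : R) (n k : nat).
Local Notation g := (baseMap lambda).
Local Notation f := (Fmap lambda).

(** The hypotheses of [covers_hits_zero] hold for all large times, because the
    expansion dominates both the position and the time by [exp_dominates]. *)
Lemma not_fatou_of_real_orbit z n k :
  complex.Im (iter n g z) = 2 * pi * k%:R -> ~ fatou_set f z.
Proof.
move=> /(horizontal_orbitP lambda_gt0) orb.
have l0 := lambda_gt0; have l2 := lambda_lt2.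
set x0 := complex.Re (iter n g z) in orb.
have large (M : R) : exists m0, (n <= m0)%N /\
    forall m, (m0 <= m)%N -> M <= complex.Re (iter m g z).
  pose j := (Num.truncn ((`|M| + `|x0|) / lambda)).+1.
  exists (n + j)%N; split; first exact: leq_addr.
  move=> m jm; have [_] := orb (m - n)%N.
  have nm : (n <= m)%N by rewrite (leq_trans _ jm)// leq_addr.
  rewrite subnKC// -/x0; apply: le_trans.
  have : (`|M| + `|x0|) / lambda < (m - n)%:R.
    by apply: (lt_le_trans (truncnS_gt _)); rewrite ler_nat leq_subRL.
  rewrite ltr_pdivrMr// mulrC.
  have := ler_norm M; have := ler_norm (- x0); rewrite normrN; lra.
apply: zeros_near_escaping_not_fatou; first exact: Fmap_continuous.
  move=> M; have [m0 [_ m0P]] := large (M + 1); exists m0 => m /m0P.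
  rewrite -Re_iter_Fmap => h; have := Re_le_normc (iter m f z).
  have := ler_norm (complex.Re (iter m f z)); lra.
move=> N /nbhs_normcP[e e0 eN].
have [X0 X0P] := @exp_dominates R lambda lambda_gt0 1000 0.
have [X1 X1P] := @exp_dominates R lambda lambda_gt0 (272 * (30 + 8 * k%:R)) 0.
have [X2 X2P] := @exp_dominates R lambda lambda_gt0
  (272 * (40 + 8 * (n%:R + `|x0| / lambda))) (272 * (1 + 8 / lambda)).
have A0 := ler_norm X0; have A1 := ler_norm X1; have A2 := ler_norm X2.
have B0 := normr_ge0 X0; have B1 := normr_ge0 X1; have B2 := normr_ge0 X2.
have [m0 [nm0 m0P]] := large (`|X0| + `|X1| + `|X2|).
have [||m1 m1P] := @covers_eventually R lambda z (disc z e) m0 (@disc_open _ z e).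
- exact: disc_center.
- move=> m mm; rewrite normc_expTerm//.
  have := X0P (complex.Re (iter m g z)); rewrite mul0r addr0 => h.
  apply: le_trans (h _); first lra.
  by apply: le_trans (m0P m mm); lra.
exists (maxn m0 m1 + 3)%N => p pm.
pose m := (p - 3)%N.
have pE : p = m.+3 by rewrite /m -addn3 subnK// (leq_trans _ pm)// leq_addl.
have : (maxn m0 m1 <= m)%N by rewrite -(leq_add2r 3) subnK// (leq_trans _ pm)// leq_addl.
rewrite geq_max => /andP[mm0 mm1].
have nm : (n <= m)%N by exact: leq_trans mm0.
have [Imm Rem] := orb (m - n)%N; rewrite subnKC// -/x0 in Imm Rem.
have [ImS ReS] := orb (m.+1 - n)%N; rewrite subnKC ?leqW// -/x0 in ImS ReS.
pose x := complex.Re (iter m g z).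
have zE : iter m g z = x +i* (2 * pi * k%:R).
  by rewrite /x -Imm; case: (iter m g z).
pose X := lambda * expR x + x + lambda.
have XE : complex.Re (iter m.+1 g z) = X.
  rewrite iterS zE baseMap_polar -[2 * pi * _]addr0 cos_turns cos0 /= mulr1 //.
rewrite XE in ReS.
have := m0P _ mm0; rewrite -/x => xl.
have := m0P _ (leqW mm0); rewrite XE => Xl.
have [||||w Nw w0] := covers_hits_zero lambda_gt0 lambda_lt2 zE (erefl X) (m1P _ mm1).
- by have := X0P x; rewrite mul0r addr0; apply; lra.
- by have := X1P X; rewrite mul0r addr0; apply; lra.
- lra.
- have := X2P X; have : X2 <= X by lra.
  move=> h /(_ h); apply: le_trans.
  have mB : m%:R <= n%:R + (X + `|x0|) / lambda.
    rewrite -lerBlDl ler_pdivlMr// mulrC.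
    have mn : m.+1%:R - n%:R = (m.+1 - n)%:R :> R by rewrite natrB// leqW.
    rewrite -mn -(natr1 m) in ReS.
    have := ler_norm (- x0); rewrite normrN; lra.
  rewrite mulrDl in mB.
  have -> : 272 * (1 + 8 / lambda) * X = 272 * X + 272 * 8 * (X / lambda) by ring.
  lra.
- by exists w; [exact: eN|rewrite pE].
Qed.

End RealOrbit.

(** * The strip and the ray around the fixed points *)

Section Basin.
Variables (R : realType) (lambda : R).
Hypotheses (lambda_gt0 : 0 < lambda) (lambda_lt2 : lambda < 2).
Implicit Types (z w : R[i]) (x s t : R) (n k : nat).
Local Notation g := (baseMap lambda).
Local Notation f := (Fmap lambda).

(** This is log ((1 + s) / (1 - s)) >= 2 s.  It is the inequality that makes 2
    the bound on [lambda]: it excludes cycles of period two of the real map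
    x + lambda (1 - e^x). *)
Lemma exp_le_cayley s : 0 <= s -> (1 - s) * expR (2 * s) <= 1 + s.
Proof.
move=> s0; pose phi (t : R) := (1 + t) * expR (- t) - (1 - t) * expR t.
have dphi (t : R) : is_derive t 1 phi (t * (expR t - expR (- t))).
  rewrite /phi; apply: is_derive_eq; rewrite /GRing.scale/=; ring.
have [|c] := @MVT_segment _ phi _ 0 s s0 (fun t _ => dphi t).
  apply: continuous_subspaceT => t.
  by apply/differentiable_continuous/derivable1_diffP; case: (dphi t).
rewrite in_itv/= => /andP[c0 cs].
have -> : phi 0 = 0 by rewrite /phi oppr0 expR0; ring.
rewrite !subr0 => phiE.
have phi0 : 0 <= phi s.
  by rewrite phiE !mulr_ge0// subr_ge0 ler_expR ge0_cp.
have : 0 <= expR s * phi s by rewrite mulr_ge0// expR_ge0.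
have -> : expR s * phi s = (1 + s) * (expR s * expR (- s)) - (1 - s) * (expR s * expR s).
  by rewrite /phi; ring.
rewrite expRxMexpNx_1 -expRD mulr1.
have -> : s + s = 2 * s by ring.
lra.
Qed.

(** The algebraic part of [ray_contraction], in a form that covers both signs
    of [s]: the roles of [lambda] and [2 - lambda] are exchanged when the sign
    changes. *)
Lemma contraction_bound (u t S m a b : R) : 0 <= t -> t <= S -> S < 1 ->
  0 < m -> m <= 1 -> m <= a -> m <= b ->
  (1 - t) * (1 + a * t) <= u -> u * (1 + b * t) <= 1 + t ->
  `|1 - u| <= (1 - m * (1 - S)) * t.
Proof.
move=> t0 tS S1 m0 m1 ma mb lo up.
have mS0 : 0 <= m * (1 - S) by rewrite mulr_ge0 ?ltW// subr_gt0.
have mSm : m * (1 - S) <= m by apply: ler_piMr (ltW m0) _; lra.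
rewrite ler_norml; apply/andP; split.
- rewrite lerNl opprB leNgt; apply/negP.
  set q := 1 - m * (1 - S) => h.
  have q0 : 0 <= q by rewrite /q; lra.
  have qb : 1 <= q + b by rewrite /q; lra.
  have b0 : 0 <= b by lra.
  have hh : 0 < 1 + b * t by rewrite ltr_pwDl// mulr_ge0.
  have : (1 + q * t) * (1 + b * t) < u * (1 + b * t).
    by rewrite ltr_pM2r//; lra.
  have : 0 <= q * b * (t * t) by rewrite !mulr_ge0.
  have : t <= (q + b) * t by rewrite ler_peMl.
  lra.
- have : a * (1 - t) * t >= m * (1 - S) * t.
    rewrite ler_wpM2r// ler_pM//; lra.
  lra.
Qed.

(** One minus the modulus of the derivative of g at its fixed points. *)
Let m := Num.min lambda (2 - lambda).

(** In the coordinate s = 1 - e^x the map x + lambda (1 - e^x) becomes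
    1 - (1 - s) e^(lambda s).  Write e^(2 s) as the product of e^(lambda s) and
    e^((2 - lambda) s), bound these factors below by their tangents,
    and use [exp_le_cayley]. *)
Lemma ray_contraction s S : `|s| <= S -> S < 1 ->
  `|1 - (1 - s) * expR (lambda * s)| <= (1 - m * (1 - S)) * `|s|.
Proof.
move=> sS S1.
have l0 := lambda_gt0; have l2 := lambda_lt2.
have m0 : 0 < m by rewrite lt_min; lra.
have ml : m <= lambda by rewrite ge_min lexx.
have mk : m <= 2 - lambda by rewrite ge_min lexx orbT.
have m1 : m <= 1 by lra.
have e1 := expR_ge1Dx ((2 - lambda) * `|s|).
have e2 := expR_ge1Dx (lambda * `|s|).
have c := exp_le_cayley (normr_ge0 s).
have split2 : expR (2 * `|s|) = expR (lambda * `|s|) * expR ((2 - lambda) * `|s|).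
  by rewrite -expRD; congr expR; ring.
rewrite split2 in c.
have E0 := expR_gt0 (lambda * `|s|).
have K0 := expR_gt0 ((2 - lambda) * `|s|).
have t1 : 0 <= 1 - `|s| by lra.
have [s0|s0] := leP 0 s.
- rewrite (ger0_norm s0) in e1 e2 c E0 K0 t1 sS *.
  apply: (contraction_bound (a := lambda) (b := 2 - lambda)) => //.
  + by rewrite ler_wpM2l.
  + apply: le_trans c; rewrite -mulrA ler_wpM2l// ler_wpM2l// ltW//.
- have [t sE] : exists t, s = - t by exists (- s); rewrite opprK.
  have t0 : 0 < t by rewrite -oppr_lt0 -sE.
  have tE : `|s| = t by rewrite sE normrN gtr0_norm.
  rewrite tE in e1 e2 c E0 K0 t1 sS *.
  rewrite sE opprK mulrN expRN.
  apply: (contraction_bound (a := 2 - lambda) (b := lambda)) => //; first exact: ltW.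
  + rewrite ler_pdivlMr//; apply: le_trans c; rewrite -mulrA ler_wpM2l//.
    by rewrite mulrC ler_wpM2l// ltW.
  + rewrite mulrAC ler_pdivrMr// ler_wpM2l//; lra.
Qed.

Definition ray x : R[i] := x +i* pi.

Lemma baseMap_ray x : g (ray x) = ray (x + lambda * (1 - expR x)).
Proof. by rewrite baseMap_polar cospi sinpi; complex_ext. Qed.

Lemma iter_ray x n : iter n g (ray x) =
  ray (iter n (fun x => x + lambda * (1 - expR x)) x).
Proof. by elim: n => // n IH; rewrite !iterS IH baseMap_ray. Qed.

Lemma ray_orbit_cvg x (d : R) : x <= 0 -> 0 < d ->
  exists n, normc (iter n g (ray x) - ray 0) < d.
Proof.
move=> x0 d0; pose xs n := iter n (fun x => x + lambda * (1 - expR x)) x.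
pose S := 1 - expR x; pose q := 1 - m * (1 - S).
have l0 := lambda_gt0; have l2 := lambda_lt2.
have ex0 := expR_gt0 x.
have ex1 : expR x <= 1 by rewrite -expR0 ler_expR.
have S1 : S < 1 by rewrite /S; lra.
have S0 : 0 <= S by rewrite /S; lra.
have m0 : 0 < m by rewrite lt_min; lra.
have m1 : m <= 1.
  have : m <= lambda by rewrite ge_min lexx.
  have : m <= 2 - lambda by rewrite ge_min lexx orbT.
  lra.
have q1 : q < 1 by rewrite /q ltrBlDr ltrDl mulr_gt0// subr_gt0.
have q0 : 0 <= q.
  have : m * (1 - S) <= 1 by apply: mulr_ile1 (ltW m0) _ m1 _; lra.
  rewrite /q; lra.
have sn n : `|1 - expR (xs n)| <= q ^+ n * S.
  elim: n => [|n IH]; first by rewrite expr0 mul1r ger0_norm.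
  rewrite /xs iterS -/(xs n) expRD.
  have snS : `|1 - expR (xs n)| <= S.
    by apply: le_trans IH _; apply: ler_piMl => //; apply: exprn_ile1 => //; exact: ltW.
  have := ray_contraction snS S1; rewrite -/q subKr => h.
  by apply: (le_trans h); rewrite exprS -mulrA ler_wpM2l.
(* |1 - e^y| <= dl <= 1 / 2 implies |y| <= 2 dl *)
pose dl := Num.min (1 / 2) (d / 4).
have dl0 : 0 < dl by rewrite lt_min; lra.
have dl1 : dl <= 1 / 2 by rewrite ge_min lexx.
have dl2 : dl <= d / 4 by rewrite ge_min lexx orbT.
have [n nP] : exists n, q ^+ n * S <= dl.
  have qlt : `|q| < 1 by rewrite ger0_norm.
  have /cvgrPdist_lt/(_ dl dl0)[n _ nP] := cvg_expr qlt.
  exists n; have := nP n (leqnn n); rewrite /= sub0r normrN ger0_norm ?exprn_ge0// => h.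
  apply: le_trans (ltW h); by apply: ler_piMr (ltW S1); rewrite exprn_ge0.
exists n; rewrite iter_ray -/(xs n).
have := le_trans (sn n) nP; rewrite ler_norml => /andP[h1 h2].
apply: le_lt_trans (normc_le_ReIm _) _; rewrite /= subr0 subrr normr0 addr0.
have u1 := expR_ge1Dx (xs n); have u2 := expR_ge1Dx (- xs n).
have v0 := expR_gt0 (xs n).
rewrite expRN in u2.
have : (1 - xs n) * expR (xs n) <= 1.
  by rewrite -ler_pdivlMr// mul1r.
move=> u3; rewrite ltr_norml; apply/andP; split; nra.
Qed.

(** At the fixed point g has derivative 1 - lambda, of modulus 1 - m; the
    quadratic error is at most 17 lambda |h|^2, which is at most m |h| within
    this radius. *)
Definition trap_radius := m / (17 * lambda).

Lemma trap_radius_gt0 : 0 < trap_radius.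
Proof.
have l0 := lambda_gt0; have l2 := lambda_lt2.
by rewrite divr_gt0 ?lt_min; lra.
Qed.

Lemma trap_radius_le1 : trap_radius <= 1.
Proof.
have l0 := lambda_gt0; have l2 := lambda_lt2.
have : m <= lambda by rewrite ge_min lexx.
by rewrite ler_pdivrMr; lra.
Qed.

Lemma iter_trap w n : normc (w - ray 0) <= trap_radius ->
  normc (iter n g w - ray 0) <= trap_radius.
Proof.
move=> w0; elim: n => // n; rewrite iterS; move: (iter n g w) => v vr.
have l0 := lambda_gt0; have l2 := lambda_lt2.
apply: (le_trans _ vr); set h := v - ray 0.
have fixp : g (ray 0) = ray 0 by rewrite baseMap_ray expR0 subrr mulr0 addr0.
have cN : expTerm lambda (ray 0) = - lambda%:C.
  by rewrite expTerm_polar cospi sinpi expR0; complex_ext.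
have -> : g v - ray 0 = (1 - lambda)%:C * h - lambda%:C * (cexp h - 1 - h).
  rewrite -{1}fixp; have -> : v = ray 0 + h by rewrite /h addrC subrK.
  rewrite baseMap_incr cN rmorphB rmorph1; ring.
apply: le_trans (normcD_le _ _) _; rewrite normc_opp !Normc.normcM !normc_real.
have hr : normc h <= trap_radius by [].
have h1 := le_trans hr trap_radius_le1.
have h0 := normc_ge0 h.
have b2 := cexp_bound2 h1.
have lr : 17 * lambda * trap_radius = m.
  by rewrite /trap_radius mulrC divfK// mulf_neq0 ?pnatr_eq0// gt_eqF.
have q : lambda * normc (cexp h - 1 - h) <= m * normc h.
  apply: (le_trans (y := lambda * (17 * normc h ^+ 2))); first by rewrite ler_wpM2l// ltW.
  rewrite -lr expr2.
  have -> : lambda * (17 * (normc h * normc h)) = (17 * lambda * normc h) * normc h by ring.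
  by rewrite ler_wpM2r// ler_wpM2l//; lra.
have c : `|1 - lambda| <= 1 - m.
  rewrite /m ler_norml /Num.min; case: ifP => mm; lra.
have : `|1 - lambda| * normc h <= (1 - m) * normc h by rewrite ler_wpM2r.
rewrite (gtr0_norm l0); lra.
Qed.

Lemma escape_of_Im_bounded w n (C : R) : - C <= complex.Im (iter n g w) ->
  n%:R <= normc (iter n f w) + C.
Proof.
move=> h; have := Im_iter_Fmap lambda n w; have := Im_le_normc (iter n f w).
have := ler_norm (complex.Im (iter n f w)).
have : n%:R <= 2 * pi * n%:R :> R.
  by rewrite ler_peMl//; have := pi_ge2 R; lra.
lra.
Qed.

(** The orbit enters the trapping disc, and so do the orbits of nearby points
    at the same time. *)
Lemma fatou_ray x : x <= 0 -> fatou_set f (ray x).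
Proof.
move=> x0; have [n nP] := ray_orbit_cvg x0 trap_radius_gt0.
pose U := iter n g @^-1` [set v | normc (v - ray 0) < trap_radius].
apply: (@uniform_escape_fatou R f U 1 n) => //.
- apply: open_comp; last exact: disc_open.
  by move=> ? _; exact: iter_baseMap_continuous.
- move=> w k Uw nk; apply: escape_of_Im_bounded.
  have kE : iter k g w = iter (k - n) g (iter n g w) by rewrite -iterD subnK.
  have := iter_trap (k - n) (ltW Uw); rewrite -kE => h.
  have := Im_le_normc (iter k g w - ray 0); rewrite ImB ler_norml /=.
  have := trap_radius_le1; have := pi_ge2 R; lra.
Qed.

(** The fixed point i pi (2 k + 1) of g, which F maps to the next one. *)
Definition fixpt k : R[i] := vert (2 * pi * k%:R + pi).

Lemma ray0E : ray 0 = fixpt 0.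
Proof. by rewrite /ray /fixpt mulr0 add0r. Qed.

Lemma iter_fixpt k n : iter n g (fixpt k) = fixpt k.
Proof.
elim: n => // n IH; rewrite iterS IH /fixpt /vert baseMap_polar cos_turns sin_turns.
by rewrite cospi sinpi expR0; complex_ext.
Qed.

Lemma iter_Fmap_fixpt k n : iter n f (fixpt k) = fixpt (k + n).
Proof.
rewrite iter_Fmap iter_fixpt /fixpt -vertD (natrD _ k n); congr vert; ring.
Qed.

Definition fixptComponent k := connected_component (fatou_set f) (fixpt k).

(** The values of Im g^n on the component form an interval, which contains
    2 pi k + pi and no multiple of 2 pi by [not_fatou_of_real_orbit]. *)
Lemma fixptComponent_strip k w n : fixptComponent k w ->
  2 * pi * k%:R < complex.Im (iter n g w) < 2 * pi * k.+1%:R.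
Proof.
move=> Cw; have pi0 := pi_gt0 R.
have Cp : fixptComponent k (fixpt k).
  have [F|nF] := pselect (fatou_set f (fixpt k)); first exact: connected_component_refl.
  by move: Cw; rewrite /fixptComponent (connected_component_out nF).
pose I : set R := (fun z => complex.Im (iter n g z)) @` fixptComponent k.
have Iitv : is_interval I.
  apply/connected_intervalP; apply: connected_continuous_connected.
    exact: component_connected.
  apply: continuous_subspaceT => z.
  by apply: continuous_comp; [exact: iter_baseMap_continuous|exact: continuous_Im].
have Ip : I (2 * pi * k%:R + pi) by exists (fixpt k); rewrite /= ?iter_fixpt.
have Iw : I (complex.Im (iter n g w)) by exists w.
have avoid j : ~ I (2 * pi * j%:R).
  move=> [z Cz] /= /(not_fatou_of_real_orbit lambda_gt0 lambda_lt2); apply.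
  exact: connected_component_sub Cz.
rewrite !ltNge; apply/andP; split; apply/negP => h.
- apply: (avoid k); apply: (Iitv _ _ Iw Ip); rewrite h /=; lra.
- apply: (avoid k.+1); apply: (Iitv _ _ Ip Iw); rewrite h andbT turnS; lra.
Qed.

End Basin.

(** * The wandering domain *)

Section WanderingDomain.
Variables (R : realType) (lambda : R).
Hypotheses (lambda_gt0 : 0 < lambda) (lambda_lt2 : lambda < 2).
Implicit Types (z w : R[i]) (x s t : R) (n k : nat).
Local Notation g := (baseMap lambda).
Local Notation f := (Fmap lambda).
Local Notation fixptComponent := (fixptComponent lambda).
Local Notation fixpt := (fixpt R).
Local Notation W := (fixptComponent 0%N).

Lemma fatou_component_fixpt (V : set R[i]) k :
  fatou_component f V -> V (fixpt k) -> V = fixptComponent k.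
Proof. by move=> [z _ ->] /same_connected_component. Qed.

(** The component would contain the fixed points [fixpt k] and [fixpt (k + p)],
    which lie in different strips. *)
Lemma fixptComponent_not_periodic k : fixptComponent k (fixpt k) ->
  ~ periodic_component f (fixptComponent k).
Proof.
move=> Ck [p p0 pE]; have pi0 := pi_gt0 R.
have : image_component f (fixptComponent k) p (fixpt k) by rewrite pE.
move=> [V [Vf Vimg] Vk]; have VE := fatou_component_fixpt Vf Vk.
have : fixptComponent k (fixpt (k + p)).
  by rewrite -(iter_Fmap_fixpt lambda) -VE; apply: Vimg; exists (fixpt k).
move=> /(fixptComponent_strip lambda_gt0 lambda_lt2 0) /andP[_] /=.
have : k.+1%:R <= (k + p)%:R :> R by rewrite ler_nat -addn1 leq_add2l.
rewrite -(ler_pM2l (x := 2 * pi)); lra.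
Qed.

Lemma base_fixpt : W (fixpt 0).
Proof. by apply: connected_component_refl; rewrite -ray0E; exact: fatou_ray. Qed.

Lemma base_fatou_component : fatou_component f W.
Proof.
by exists (fixpt 0) => //; exact: (connected_component_sub base_fixpt).
Qed.

(** The component containing the image of W under the j-th iterate can only be
    that of [fixpt j].  If there were none, [image_component] would be the empty
    set, whose own image components have all Fatou components as union. *)
Lemma base_wandering : wandering_domain f W.
Proof.
split; [exact: base_fatou_component|exact: fixptComponent_not_periodic base_fixpt|].
move=> [_ [j j0]].
have [[V [Vf Vimg]]|noV] :=
    pselect (exists V, fatou_component f V /\ iter j f @` W `<=` V).
- have fixV V' : iter j f @` W `<=` V' -> V' (fixpt j).
    move=> V'img; rewrite -[j]add0n -(iter_Fmap_fixpt lambda); apply: V'img.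
    by exists (fixpt 0) => //; exact: base_fixpt.
  have VE := fatou_component_fixpt Vf (fixV _ Vimg).
  have -> : image_component f W j = fixptComponent j.
    apply/seteqP; split=> [w [V' [Vf' Vimg'] V'w]|w Cw].
      by rewrite -(fatou_component_fixpt Vf' (fixV _ Vimg')).
    by exists V; [split|rewrite VE].
  by apply: fixptComponent_not_periodic; rewrite -VE; exact: fixV.
- have -> : image_component f W j = set0.
    by apply/seteqP; split=> [w [V VP _]|//]; apply: noV; exists V.
  move=> [p _ /seteqP[pE _]]; apply: (pE (fixpt 0)).
  exists W; last exact: base_fixpt.
  by split; [exact: base_fatou_component|rewrite image_set0].
Qed.

Lemma base_escaping : escaping f W.
Proof.
move=> z Wz; apply/cvgryPge => A.
exists (Num.truncn A).+1 => // n /= An.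
have /andP[h _] := fixptComponent_strip lambda_gt0 lambda_lt2 n Wz.
rewrite mulr0 in h.
have := @escape_of_Im_bounded R lambda z n 0; rewrite oppr0 addr0 => /(_ (ltW h)).
apply: le_trans; apply: (le_trans (ltW (truncnS_gt A))).
by rewrite ler_nat.
Qed.

Lemma base_ray x : x <= 0 -> W (ray x).
Proof.
move=> x0; pose L : set R[i] := [set ray y | y in [set y | y <= 0]].
apply: (@connected_component_max _ (fatou_set f) L (fixpt 0)); last by exists x.
- by exists 0; [exact: lexx|exact: ray0E].
- by move=> _ [y /= y0 <-]; exact: fatou_ray.
- apply: (@star_shaped_connected _ L (ray 0)); first by exists 0; [exact: lexx|].
  move=> _ t [y /= y0 <-] /andP[t0 t1]; exists (t * y) => /=.
    by rewrite mulr_ge0_le0.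
  by rewrite /ray; complex_ext.
Qed.

Lemma base_unbounded (A : set R[i]) : W `<=` A -> ~ bounded_set A.
Proof.
move=> WA /bounded_normc[M AM].
have x0 : - (`|M| + 1) <= 0 by rewrite oppr_le0 addr_ge0.
have := AM _ (WA _ (base_ray x0)); have := Re_le_normc (ray (- (`|M| + 1))).
rewrite /= normrN ger0_norm ?addr_ge0//; have := ler_norm M; lra.
Qed.

(** The maximum principle for Im g^n: an extremum on [K] that violates the
    bounds would be an extremum on the open set [K `|` W], but the image of this
    set by g^n is open. *)
Lemma filled_strip (K : set R[i]) : compact K -> open (K `|` W) ->
  forall n z, (K `|` W) z -> 0 < complex.Im (iter n g z) < 2 * pi.
Proof.
move=> cK Uo n; pose v z := complex.Im (iter n g z).
have cv : {within K, continuous (v : R[i] -> R)}.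
  apply: continuous_subspaceT => z.
  by apply: continuous_comp; [exact: iter_baseMap_continuous|exact: continuous_Im].
have Wv z : W z -> 0 < v z < 2 * pi.
  move=> /(fixptComponent_strip lambda_gt0 lambda_lt2 n); by rewrite mulr0 mulr1.
(* openness of g^n moves Im g^n by any small amount in both directions *)
have nudge c : K c -> exists2 e, 0 < e &
    forall s, `|s| < e -> exists2 u, (K `|` W) u & v u = v c + s.
  move=> Kc.
  have [|e e0 eP] := (open_normcP _).1 (@iter_baseMap_open R lambda n _ Uo) (iter n g c).
    by exists c => //; left.
  exists e => // s se.
  have [|u Uu uE] := eP (iter n g c + vert s).
    by rewrite addrAC subrr add0r /= expr0n add0r sqrtr_sqr.
  by exists u => //; rewrite /v uE ImD.
move=> z [Kz|]; last exact: Wv.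
have K0 : K !=set0 by exists z.
apply/andP; split.
- have [c] := compact_EVT_min K0 cK cv; rewrite inE => Kc cmin.
  apply: lt_le_trans (cmin z _); last by rewrite inE.
  rewrite ltNge; apply/negP => c0.
  have [e e0 eP] := nudge c Kc.
  have [|u [Ku|Wu] uE] := eP (- (e / 2)).
  + by rewrite normrN gtr0_norm; lra.
  + have := cmin u; rewrite inE => /(_ Ku); lra.
  + have := Wv u Wu; lra.
- have [c] := compact_EVT_max K0 cK cv; rewrite inE => Kc cmax.
  apply: le_lt_trans (cmax z _) _; first by rewrite inE.
  rewrite ltNge; apply/negP => c0.
  have [e e0 eP] := nudge c Kc.
  have [|u [Ku|Wu] uE] := eP (e / 2).
  + by rewrite gtr0_norm; lra.
  + have := cmax u; rewrite inE => /(_ Ku); lra.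
  + have := Wv u Wu; lra.
Qed.

(** [K] is contained in the Fatou set.  A disc around a point of [K] that meets
    W would join this point to W inside the Fatou set, so [K] is open as well as
    closed; it is empty since the plane is connected and W is not empty. *)
Lemma no_compact_hole (K : set R[i]) : compact K -> closed K ->
  K `<=` ~` W -> open (K `|` W) -> K = set0.
Proof.
move=> cK clK KW Uo.
have UF : K `|` W `<=` fatou_set f.
  apply: (@uniform_escape_fatou R f _ 0 0) => // z n Uz _.
  apply: escape_of_Im_bounded; rewrite oppr0.
  by have /andP[/ltW] := filled_strip cK Uo n Uz.
have Ko : open K.
  apply/open_normcP => p Kp.
  have [|e e0 eU] := (open_normcP _).1 Uo p; first by left.
  exists e => // w wp; have [//|Ww] := eU _ wp.
  case: (KW _ Kp); rewrite /fixptComponent (same_connected_component Ww).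
  apply: (@connected_component_max _ _ (disc p e)) => //.
  - by move=> u /eU; exact: UF.
  - exact: disc_connected.
  - exact: disc_center.
apply: contrapT => /eqP/set0P K0.
have := @plane_connected R K K0.
have KT : K = [set: R[i]] `&` K by rewrite setTI.
move=> /(_ (ex_intro2 _ _ K Ko KT) (ex_intro2 _ _ K clK KT)) KE.
by apply: (KW (fixpt 0)); [rewrite KE|exact: base_fixpt].
Qed.

(** A relatively clopen piece of the complement that misses infinity is a
    compact hole. *)
Lemma base_simply_connected : simply_connected W.
Proof.
have Wo : open W by apply: connected_component_open; exact: fatou_set_open.
split => //; first exact: component_connected.
set A := ~` finite_pts W.
have clA : closed A.
  by apply: open_closedC; exact: one_point_compactification_open_some.
have ANone : A None by move=> [z _].
have hole (K C1 C2 : set (sphere R)) : open C1 -> closed C2 ->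
    K = A `&` C1 -> K = A `&` C2 -> ~ K None -> K = set0.
  move=> oC1 cC2 KC1 KC2 nK.
  have clK : closed K by rewrite KC2; exact: closedI.
  have : nbhs (None : sphere R) (~` K).
    by apply: open_nbhs_nbhs; split => //; exact: closed_openC.
  move=> [D [cD clD] DK].
  pose Kf := [set z : R[i] | K (Some z)].
  have clKf : closed Kf.
    apply: closed_comp clK => z _; exact: one_point_compactification_some_continuous.
  have cKf : compact Kf.
    apply: (subclosed_compact clKf cD) => z Kz; apply: contrapT => Dz.
    by apply: (DK (Some z)) => //; left; exists z.
  have Kf0 : Kf = set0.
    apply: no_compact_hole => //.
    + by move=> z; rewrite /Kf/= KC1 => -[Az _] Wz; apply: Az; exists z.
    + rewrite openE => z Uz.
      have [Wz|nWz] := pselect (W z).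
        apply: (filterS (P := W)); first by move=> w; right.
        exact: open_nbhs_nbhs.
      have Kz : K (Some z) by case: Uz.
      have : nbhs (Some z : sphere R) C1.
        by apply: open_nbhs_nbhs; split => //; move: Kz; rewrite KC1 => -[].
      move=> C1z; apply: (filterS (P := Some @^-1` C1)); last exact: C1z.
      move=> w C1w.
      have [Ww|nWw] := pselect (W w); [by right|left].
      by rewrite /Kf/= KC1; split => // -[u Wu [uw]]; apply: nWw; rewrite -uw.
  apply/seteqP; split => // -[z|] Kz //.
  suff : Kf z by rewrite Kf0.
  exact: Kz.
move=> B B0 [C1 oC1 BC1] [C2 cC2 BC2].
have [BN|nBN] := pselect (B None); last first.
  by case: B0 => b; rewrite (hole B C1 C2).
have compl1 : A `\` B = A `&` ~` C2.
  by rewrite BC2 setDIr setDv set0U.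
have compl2 : A `\` B = A `&` ~` C1.
  by rewrite BC1 setDIr setDv set0U.
have AB : A `\` B = set0.
  apply: (hole _ (~` C2) (~` C1)) => //; [exact: closed_openC|exact: open_closedC|].
  by move=> [_].
apply/seteqP; split => [x|x Ax]; first by rewrite BC1 => -[].
apply: contrapT => nBx; suff : (A `\` B) x by rewrite AB.
by split.
Qed.

(** W and the segment [S] from 0 to i pi are used as the unbounded connected
    set through 0; [n] is such that the iterate is at distance more than 4 > pi
    from 0. *)
Lemma no_baker_wandering_domain (B : set R[i]) : ~ baker_wandering_domain f B.
Proof.
move=> [_ bnd [N Nsurr] dist].
have /cvgryPgt/(_ 4)[n1 _ n1P] := dist.
pose n := maxn N n1; pose E := image_component f B n.+1.
have [_ [x Ex [[D bD KD] zK]]] := Nsurr n (leq_maxl _ _).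
have Edist : 4 < dist0 E by apply: n1P => /=; rewrite leqW// leq_maxr.
have [[w Ww [V [Vf Vimg] Vw]]|disj] := pselect (exists2 w, W w & E w).
  apply: (base_unbounded _ (bnd n.+1)) => u Wu; exists V => //.
  case: Vf Vw => z _ -> zw.
  by rewrite (same_connected_component zw) -(same_connected_component Ww).
pose S : set R[i] := [set vert t | t in `[0, pi]%classic].
have Sconn : connected S.
  apply: (@star_shaped_connected _ S 0).
    by exists 0; rewrite ?/= ?in_itv/= ?lexx ?pi_ge0.
  move=> _ t [s /= + <-] /andP[t0 t1]; rewrite !in_itv/= => /andP[s0 spi].
  exists (t * s); last by rewrite /vert; complex_ext.
  by rewrite /= in_itv/= mulr_ge0//= (le_trans _ spi)// ler_piMl.
have Sfix : S (fixpt 0).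
  by exists pi; rewrite /= ?in_itv/= ?pi_ge0 ?lexx// /fixpt mulr0 add0r.
have Zconn : connected (S `|` W).
  apply: connectedU => //; last exact: component_connected.
  by exists (fixpt 0); split => //; exact: base_fixpt.
have ZE : finite_pts (S `|` W) `<=` ~` finite_pts E.
  move=> _ [z Zz <-] [u Eu [uz]]; rewrite {u}uz in Eu; case: Zz => [|Wz].
    move=> [t /= + tz]; rewrite in_itv/= => /andP[t0 tpi].
    have : dist0 E <= normc z.
      apply: ge_inf; last by exists z.
      by exists 0 => _ [u _ <-]; exact: normc_ge0.
    rewrite -tz /= expr0n add0r sqrtr_sqr ger0_norm//.
    have := pi_le4 R; lra.
  by apply: disj; exists z.
have Z0 : finite_pts (S `|` W) (Some 0).
  by exists 0 => //; left; exists 0; rewrite /= ?in_itv/= ?lexx ?pi_ge0.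
have K0 : connected_component (~` finite_pts E) x (Some 0) by apply: zK; exists 0.
have : finite_pts (S `|` W) `<=` connected_component (~` finite_pts E) x.
  rewrite (same_connected_component K0); apply: connected_component_max => //.
  apply: connected_continuous_connected => //.
  apply: continuous_subspaceT; exact: one_point_compactification_some_continuous.
rewrite KD => ZD; apply: (base_unbounded _ bD) => u Wu.
by have [|v Dv [<-]] := ZD (Some u); first by exists u => //; right.
Qed.

End WanderingDomain.

Close Scope complex_scope.
Unset Implicit Arguments.
Set Strict Implicit.

Theorem mainTheorem6 (R : realType) (lambda : R)
    (hlambda0 : 0 < lambda) (hlambda2 : lambda < 2) :
  (exists W : set R[i],
     [/\ wandering_domain (Fmap lambda) W,
         simply_connected W,
         ~ bounded_set W
       & escaping (Fmap lambda) W]) /\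
  ~ (exists W : set R[i], baker_wandering_domain (Fmap lambda) W).
Proof.
split; last by move=> [B]; exact: no_baker_wandering_domain.
exists (fixptComponent lambda 0%N); split.
- exact: base_wandering.
- exact: base_simply_connected.
- exact: (base_unbounded hlambda0 hlambda2 (@subset_refl _ _)).
- exact: base_escaping.
Qed.
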